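(* Let $G$ be a finitely generated group that splits as a graph of groups. Suppose that all edge groups are finitely generated and undistorted in $G$, and that $(\partial_M E,G)=\emptyset$ for every edge group $E$. If a connected component $\mathcal{C}\subseteq\partial_M G$ is not a singleton, then there exists a vertex group $V\leq G$ such that $\mathcal{C}$ is contained in the image of the natural injection $(\partial_M V,G)\hookrightarrow\partial_M G$. Furthermore, if $V_1,V_2$ are distinct vertex groups, then $(\partial_M V_1,G)\cap(\partial_M V_2,G)=\emptyset$, where both sets are viewed as subsets of $\partial_M G$ via the natural injections.
   Context: Splittings. A finitely generated group $G$ splits as a graph of groups if it acts without inversions and without a global fixed point (non-elliptically) on a simplicial tree $T$; we fix such an action. Vertex groups are the $G$-stabilisers of vertices of $T$, and edge groups are the $G$-stabilisers of edges of $T$. A finitely generated subgroup $H\leq G$ is undistorted if the inclusion is a quasi-isometric embedding with respect to word metrics. (When all edge groups are finitely generated and undistorted in $G$, so are all vertex groups, so that $(\partial_M V,G)$ below makes sense.) Morse boundaries. A $C$-quasi-geodesic is a $(C,C)$-quasi-geodesic, i.e. a map $\gamma$ from an interval with $\frac1C|s-t|-C\leq d(\gamma(s),\gamma(t))\leq C|s-t|+C$. Let $X$ be a proper geodesic metric space. A quasi-geodesic $\gamma\subseteq X$ is $N$-Morse, for a function $N\colon[1,+\infty)\to[0,+\infty)$ (a Morse gauge), if every $C$-quasi-geodesic with endpoints on $\gamma$ is contained in the $N(C)$-neighbourhood of $\gamma$; it is Morse if it is $N$-Morse for some $N$. For a basepoint $p\in X$, $\partial_M^N X_p$ is the set of $N$-Morse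 geodesic rays based at $p$, identifying rays at finite Hausdorff distance, with the compact-open topology. Let $\partial_M X_p=\bigcup_N\partial_M^N X_p$, where a subset $U$ is open (resp. closed) if and only if $U\cap\partial_M^N X_p$ is open (resp. closed) in $\partial_M^N X_p$ for every $N$. Up to canonical homeomorphism this does not depend on $p$; it is denoted $\partial_M X$. For a finitely generated group $G$, $\partial_M G$ is the Morse boundary of a Cayley graph with respect to a finite generating set (well defined up to homeomorphism). Relative Morse boundary. Let $H\leq G$ be finitely generated groups with $H$ undistorted in $G$, and let $i\colon\Lambda\to\Gamma$ be a quasi-isometric embedding between Cayley graphs of $H$ and $G$ extending the inclusion. Then $(\partial_M H,G)$ is the subset of points $[\gamma]\in\partial_M H$ such that $i\circ\gamma$ is Morse in $\Gamma$, with the subspace topology from $\partial_M H$. The natural injection $(\partial_M H,G)\hookrightarrow\partial_M G$ maps $[\gamma]$ to the class of a Morse geodesic ray of $\Gamma$ at finite Hausdorff distance from $i\circ\gamma$. *)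

(* Defs.v *)
From HB Require Import structures.
From mathcomp Require Import all_boot all_order all_algebra.
From mathcomp Require Import all_classical all_reals.
From mathcomp Require Import topology.

Set Implicit Arguments.
Unset Strict Implicit.
Unset Printing Implicit Defensive.

Import Order.TTheory GRing.Theory Num.Theory.
Import numFieldTopology.Exports.
Local Open Scope classical_set_scope.
Local Open Scope ring_scope.

(* Connected simple graphs; they serve both as Cayley graphs and as trees. *)
Record cgraph := CGraph {
  vertex : choiceType;
  adj : rel vertex;
  adj_sym : symmetric adj;
  adj_irr : irreflexive adj;
  adj_conn : forall u v, exists2 p, path adj u p & last u p = v }.

(* Acyclicity: a nonempty simple cycle of a simple graph has length at least 3,
   but [ucycle] also accepts [::] and the degenerate [:: u; v]. *)
Definition is_tree (T : cgraph) : Prop :=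
  inhabited (vertex T) /\
  forall c : seq (vertex T), ucycle (@adj T) c -> (size c <= 2)%N.

Section Realization.
Variables (R : realType) (K : cgraph).

Definition segment (u v : vertex K) (t : R) : vertex K -> R :=
  fun w => (1 - t) * (w == u)%:R + t * (w == v)%:R.

(* The geometric realisation, in barycentric coordinates; [u = v] only matters
   for the graph with one vertex. *)
Record realization := Realization {
  coord : vertex K -> R;
  coordP : exists u v t,
    [/\ u = v \/ adj u v, 0 <= t <= 1 & coord = segment u v t] }.

HB.instance Definition _ := gen_eqMixin realization.
HB.instance Definition _ := gen_choiceMixin realization.

Lemma vertex_point_subproof (u : vertex K) : exists u' v t,
  [/\ u' = v \/ adj u' v, 0 <= t <= 1 & segment u u 0 = segment u' v t].
Proof. by exists u, u, 0; split=> //; [left | rewrite lexx ler01]. Qed.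

Definition vertex_point (u : vertex K) : realization :=
  Realization (vertex_point_subproof u).

(* [chain x y l]: x and y are joined by a chain of segments, each contained in
   an edge of length 1, of total length l. *)
Inductive chain (x : realization) : realization -> R -> Prop :=
| chain_nil : chain x x 0
| chain_step y z l u v s t :
    chain x y l -> adj u v -> 0 <= s <= 1 -> 0 <= t <= 1 ->
    coord y = segment u v s -> coord z = segment u v t ->
    chain x z (l + `|s - t|).

Definition rdist (x y : realization) : R := inf [set l | chain x y l].

Lemma coord_inj x y : coord x = coord y -> x = y.
Proof.
by case: x => x px; case: y => y py /= e; subst y; rewrite (Prop_irrelevance px py).
Qed.

Lemma chain_cat x y z l m : chain x y l -> chain y z m -> chain x z (l + m).
Proof.
move=> xy; elim=> [|a b k u v s t _ IH uv s1 t1 ea eb]; first by rewrite addr0.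
by rewrite addrA; exact: chain_step IH uv s1 t1 ea eb.
Qed.

Lemma chain_rev x y l : chain x y l -> chain y x l.
Proof.
elim=> [|a b k u v s t _ IH uv s1 t1 ea eb]; first exact: chain_nil.
rewrite addrC; apply: chain_cat IH; rewrite distrC -[`|_|]add0r.
exact: chain_step (chain_nil _) uv t1 s1 eb ea.
Qed.

Lemma chain_coord x y l w : chain x y l -> `|coord x w - coord y w| <= l.
Proof.
elim=> [|a b k u v s t _ IH uv s1 t1 ea eb]; first by rewrite subrr normr0.
rewrite (le_trans (ler_distD (coord a w) _ _))// lerD// ea eb /segment.
case: (eqVneq w u) => [->|_]; case: (eqVneq _ v) => [e|_].
- by rewrite e adj_irr in uv.
- by rewrite !mulr1 !mulr0 !addr0 opprB addrC addrA subrK distrC.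
- by rewrite !mulr1 !mulr0 !add0r.
- by rewrite !mulr0 !addr0 subrr normr0.
Qed.

Lemma chain_ge0 x y l : chain x y l -> 0 <= l.
Proof.
by elim=> // a b k u v s t _ IH *; rewrite addr_ge0.
Qed.

Lemma segment0 u v : segment u v 0 = segment u u 0.
Proof. by apply/funext => w; rewrite /segment !mul0r. Qed.

Lemma segment1 u v : segment u v 1 = segment v v 0.
Proof.
by apply/funext => w; rewrite /segment subrr mul0r mul1r subr0 mul1r mul0r addr0 add0r.
Qed.

Lemma segmentxx u t : segment u u t = segment u u 0.
Proof.
by apply/funext => w; rewrite /segment -mulrDl subrK subr0 mul0r addr0 mul1r.
Qed.

Lemma chain_vertex x : exists u l, chain (vertex_point u) x l.
Proof.
have [u [v [t [uv t1 e]]]] := coordP x; exists u.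
case: uv => [uv|uv].
  exists 0; suff -> : x = vertex_point u by exact: chain_nil.
  by apply: coord_inj; rewrite e uv /= segmentxx.
exists (0 + `|0 - t|); apply: chain_step (chain_nil _) uv _ t1 _ e.
  by rewrite lexx ler01.
by rewrite /= segment0.
Qed.

Lemma chain_vertices u v : exists l, chain (vertex_point u) (vertex_point v) l.
Proof.
have [p] := adj_conn u v; elim: p u => [|w p IH] u /=.
  by move=> _ ->; exists 0; exact: chain_nil.
move=> /andP[uw wp] e; have [l c] := IH _ wp e.
exists (0 + `|0 - 1| + l); apply: chain_cat c.
apply: chain_step (chain_nil _) uw _ _ _ _; rewrite ?lexx ?ler01 //=.
  by rewrite segment0.
by rewrite segment1.
Qed.

Lemma chain_ex x y : exists l, chain x y l.
Proof.
have [u [l xu]] := chain_vertex x; have [v [m vy]] := chain_vertex y.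
have [k uv] := chain_vertices u v.
by exists (l + (k + m)); apply: chain_cat (chain_rev xu) (chain_cat uv vy).
Qed.

Lemma chain_has_inf x y : has_inf [set l | chain x y l].
Proof.
split; first by have [l c] := chain_ex x y; exists l.
by exists 0 => l /chain_ge0.
Qed.

Lemma rdist_le x y l : chain x y l -> rdist x y <= l.
Proof. by move=> c; apply: ge_inf => //; case: (chain_has_inf x y). Qed.

Lemma rdist_ge x y m : (forall l, chain x y l -> m <= l) -> m <= rdist x y.
Proof.
by move=> h; apply: lb_le_inf; [case: (chain_has_inf x y)|exact: h].
Qed.

Lemma rdistxx x : rdist x x = 0.
Proof.
apply/eqP; rewrite eq_le; apply/andP; split; first exact/rdist_le/chain_nil.
by apply: rdist_ge => l /chain_ge0.
Qed.

Lemma rdist_eq0 x y : rdist x y = 0 -> x = y.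
Proof.
move=> e; apply: coord_inj; apply/funext => w; apply/eqP.
rewrite -subr_eq0 -normr_le0 -e; apply: rdist_ge => l; exact: chain_coord.
Qed.

Lemma rdist_sym x y : rdist x y = rdist y x.
Proof.
by apply/eqP; rewrite eq_le; apply/andP; split; apply: rdist_ge => l /chain_rev/rdist_le.
Qed.

Lemma rdist_triangle y x z : rdist x z <= rdist x y + rdist y z.
Proof.
rewrite -lerBlDr; apply: rdist_ge => l xy; rewrite lerBlDr addrC -lerBlDr.
by apply: rdist_ge => m yz; rewrite lerBlDr addrC; apply/rdist_le/chain_cat/yz.
Qed.

HB.instance Definition _ :=
  isMetric.Build R realization rdistxx rdist_eq0 rdist_sym rdist_triangle.

End Realization.

Section QuasiIsometry.
Variable R : realType.

Definition qi_on (X Y : Type) (dX : X -> X -> R) (dY : Y -> Y -> R)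
    (C : R) (A : set X) (f : X -> Y) : Prop :=
  forall x y, A x -> A y ->
    C^-1 * dX x y - C <= dY (f x) (f y) <= C * dX x y + C.

Definition qi_embedding (X Y : Type) (dX : X -> X -> R) (dY : Y -> Y -> R)
    (f : X -> Y) : Prop :=
  exists2 C, 1 <= C & qi_on dX dY C setT f.

End QuasiIsometry.

Section MorseBoundary.
Variables (R : realType) (X : metricType R).

Definition quasi_geodesic (C a b : R) (q : R -> X) : Prop :=
  qi_on (fun s t : R => `|s - t|) (@mdist R X) C `[a, b] q.

Definition neighbourhood (A : set X) (r : R) : set X :=
  [set x | inf [set mdist x y | y in A] <= r].

(* Only the values of a Morse gauge on [1, +oo[ are relevant. *)
Definition morse_gauge (N : R -> R) : Prop := forall C, 1 <= C -> 0 <= N C.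

(* The Morse condition on a quasi-geodesic depends only on its image A. *)
Definition morse_with (N : R -> R) (A : set X) : Prop :=
  forall C a b q, 1 <= C -> a <= b -> quasi_geodesic C a b q ->
    A (q a) -> A (q b) -> q @` `[a, b] `<=` neighbourhood A (N C).

Definition morse (A : set X) : Prop :=
  exists2 N, morse_gauge N & morse_with N A.

Definition finite_hausdorff (A B : set X) : Prop :=
  exists D : R, (forall x, A x -> exists2 y, B y & mdist x y <= D) /\
                (forall y, B y -> exists2 x, A x & mdist x y <= D).

Local Notation halfline := (set_type [set t : R | 0 <= t]).

Definition geodesic_ray (p : X) (c : halfline -> X) : Prop :=
  (forall t, \val t = 0 -> c t = p) /\
  (forall s t, mdist (c s) (c t) = `|\val s - \val t|).

Variable p : X.

(* As a [set_type] over [{compact-open, _ -> _}], the N-Morse rays carry the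
   subspace topology of the compact-open topology. *)
Definition morse_rays (N : R -> R) : set {compact-open, halfline -> X} :=
  [set c | geodesic_ray p c /\ morse_with N (range c)].

Definition is_morse_ray : pred (halfline -> X) :=
  fun c => `[< geodesic_ray p c /\ morse (range c) >].

Definition morse_ray : Type := {c : halfline -> X | is_morse_ray c}.

HB.instance Definition _ := Choice.on morse_ray.

Definition asymptotic (c d : morse_ray) : bool :=
  `[< finite_hausdorff (range (\val c)) (range (\val d)) >].

Lemma asymptotic_refl : reflexive asymptotic.
Proof.
by move=> c; apply/asboolP; exists 0; split=> x cx; exists x => //; rewrite mdistxx.
Qed.

Lemma asymptotic_sym : symmetric asymptotic.
Proof.
move=> c d; apply/asboolP/asboolP => -[D [h1 h2]]; exists D;
  by split=> [x /h2|x /h1] [y ? ?]; exists y => //; rewrite metric_sym.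
Qed.

Lemma asymptotic_trans : transitive asymptotic.
Proof.
move=> d c e /asboolP[D [cd dc]] /asboolP[E [de ed]].
apply/asboolP; exists (D + E); split.
- move=> x /cd[y /de[z ez yz] xy]; exists z => //.
  by rewrite (le_trans (metric_triangle _ y _))// lerD.
- move=> z /ed[y /dc[x cx xy] yz]; exists x => //.
  by rewrite (le_trans (metric_triangle _ y _))// lerD.
Qed.

Canonical asymptotic_equiv :=
  EquivRel asymptotic asymptotic_refl asymptotic_sym asymptotic_trans.

Definition morse_boundary : Type := {eq_quot asymptotic}%qT.

HB.instance Definition _ := Choice.on morse_boundary.

Definition endpoint (c : morse_ray) : morse_boundary :=
  (\pi_({eq_quot asymptotic}%qT) c)%qT.

Lemma endpointP (c d : morse_ray) : endpoint c = endpoint d <-> asymptotic c d.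
Proof.
have h := @eqmodP _ asymptotic_equiv c d.
by split=> [e|e]; [apply/h; exact: e | exact: (elimT h e)].
Qed.

Lemma stratum_subproof N : morse_gauge N -> forall c : set_type (morse_rays N),
  is_morse_ray (\val c).
Proof.
move=> gN [c /= /set_mem [gc mc]]; apply/asboolP; split=> //; by exists N.
Qed.

Definition stratum_map N (gN : morse_gauge N) (c : set_type (morse_rays N)) :
  morse_boundary := endpoint (exist is_morse_ray _ (stratum_subproof gN c)).

(* The stratum of gauge N is the image of [stratum_map gN] with the quotient
   topology, so that U meets it in an open subset if and only if the preimage of
   U under [stratum_map gN] is open. *)
Definition boundary_open (U : set morse_boundary) : Prop :=
  forall N (gN : morse_gauge N), open (stratum_map gN @^-1` U).

Lemma boundary_openT : boundary_open setT.
Proof. by move=> N gN; rewrite preimage_setT; exact: openT. Qed.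

Lemma boundary_openI : setI_closed boundary_open.
Proof. by move=> U V oU oV N gN; rewrite preimage_setI; exact: openI. Qed.

Lemma boundary_open_bigU (I : Type) (f : I -> set morse_boundary) :
  (forall i, boundary_open (f i)) -> boundary_open (\bigcup_i f i).
Proof.
move=> oF N gN; rewrite preimage_bigcup; apply: bigcup_open => i _; exact: oF.
Qed.

HB.instance Definition _ := isOpenTopological.Build morse_boundary
  boundary_openT boundary_openI boundary_open_bigU.

End MorseBoundary.

Section Groups.
Local Open Scope group_scope.

Definition letters (G : groupType) (S : seq G) : pred G :=
  [pred x | (x \in S) || (x^-1 \in S)].

Record generators (G : groupType) := Generators {
  gens :> seq G;
  gensP : forall g : G, exists2 w, all (letters gens) w & \prod_(x <- w) x = g }.

Lemma word_ex (G : groupType) (S : generators G) (g : G) : exists n : nat,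
  `[< exists w, [/\ all (letters S) w, \prod_(x <- w) x = g & size w = n] >].
Proof. by have [w ? ?] := gensP S g; exists (size w); apply/asboolP; exists w. Qed.

Definition word_length (G : groupType) (S : generators G) (g : G) : nat :=
  ex_minn (word_ex S g).

Definition word_dist (R : realType) (G : groupType) (S : generators G)
  (g h : G) : R := (word_length S (g^-1 * h))%:R%R.

(* Loops and multiple edges are discarded. *)
Definition cayley_adj (G : groupType) (S : seq G) : rel G :=
  fun g h => (g != h) && (g^-1 * h \in letters S).

Lemma cayley_sym (G : groupType) (S : seq G) : symmetric (cayley_adj S).
Proof.
move=> g h; rewrite /cayley_adj eq_sym !inE; congr (_ && _).
by rewrite orbC !invgM !invgK.
Qed.

Lemma cayley_irr (G : groupType) (S : seq G) : irreflexive (cayley_adj S).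
Proof. by move=> g; rewrite /cayley_adj eqxx. Qed.

Lemma cayley_conn (G : groupType) (S : generators G) (g h : G) :
  exists2 p, path (cayley_adj S) g p & last g p = h.
Proof.
have [w] := gensP S (g^-1 * h); elim: w g => [|x w IH] g /=.
  rewrite big_nil => _ e; exists [::] => //=.
  by rewrite -[h](mulVKg g) -e mulg1.
move=> /andP[Sx Sw]; rewrite big_cons => e.
have e' : \prod_(y <- w) y = (g * x)^-1 * h by rewrite invgM -mulgA -e mulKg.
have [p gp lp] := IH (g * x) Sw e'.
case: (eqVneq g (g * x)) => [gx|gx]; first by exists p; rewrite // gx.
exists (g * x :: p) => //=; rewrite gp andbT /cayley_adj gx /= mulKg.
exact: Sx.
Qed.

Definition cayley_graph (G : groupType) (S : generators G) : cgraph :=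
  CGraph (@cayley_sym G S) (@cayley_irr G S) (cayley_conn S).

Definition subgroup (G : groupType) (H : groupClosed G) : Type :=
  {g : G | g \in H}.

HB.instance Definition _ (G : groupType) (H : groupClosed G) :=
  SubChoice.on (subgroup H).

Lemma subgroup_subproof (G : groupType) (H : groupClosed G) :
  group_closed (fun g : G => g \in H).
Proof.
by split=> [|g h gH hH]; [exact: gpred1 | exact: gpredM gH (gpredVr _ hH)].
Qed.

HB.instance Definition _ (G : groupType) (H : groupClosed G) :=
  SubChoice_isSubGroup.Build G _ (subgroup H) (@subgroup_subproof G H).

Definition fg_undistorted (R : realType) (G : groupType) (S : generators G)
    (H : groupClosed G) : Prop :=
  exists SH : generators (subgroup H),
    qi_embedding (word_dist R SH) (word_dist R S) (fun h => \val h).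

Record graph_action (G : groupType) (T : cgraph) := GraphAction {
  act : G -> vertex T -> vertex T;
  act1 : forall v, act 1 v = v;
  actM : forall g h v, act (g * h) v = act g (act h v);
  act_adj : forall g u v, adj (act g u) (act g v) = adj u v }.

Section Stabilisers.
Variables (G : groupType) (T : cgraph) (a : graph_action G T).

Definition without_inversions : Prop :=
  forall g u v, adj u v -> ~ (act a g u = v /\ act a g v = u).

Definition elliptic : Prop := exists v, forall g, act a g v = v.

Definition vertex_group (v : vertex T) : {pred G} := fun g => act a g v == v.

(* The stabiliser of the unoriented edge {u, v}. *)
Definition edge_group (u v : vertex T) : {pred G} := fun g =>
  (act a g u == u) && (act a g v == v) || (act a g u == v) && (act a g v == u).

Lemma actK g v : act a g^-1 (act a g v) = v.
Proof. by rewrite -actM mulVg act1. Qed.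

Lemma vertex_groupM v : mulg_closed (vertex_group v).
Proof.
by move=> g h; rewrite !unfold_in /vertex_group actM => /eqP gv /eqP ->; rewrite gv.
Qed.

Lemma vertex_group1 v : 1 \in vertex_group v.
Proof. by rewrite unfold_in /vertex_group act1. Qed.

Lemma vertex_groupV v : invg_closed (vertex_group v).
Proof.
by move=> g; rewrite !unfold_in /vertex_group => /eqP gv; rewrite -{1}gv actK.
Qed.

HB.instance Definition _ v := isMulClosed.Build G (vertex_group v) (@vertex_groupM v).
HB.instance Definition _ v := isMul1Closed.Build G (vertex_group v) (vertex_group1 v).
HB.instance Definition _ v := isInvClosed.Build G (vertex_group v) (@vertex_groupV v).

Lemma edge_groupM u v : mulg_closed (edge_group u v).
Proof.
move=> g h; rewrite !unfold_in /edge_group !actM.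
by case/orP=> /andP[/eqP gu /eqP gv]; case/orP=> /andP[/eqP -> /eqP ->];
  rewrite gu gv !eqxx ?orbT.
Qed.

Lemma edge_group1 u v : 1 \in edge_group u v.
Proof. by rewrite unfold_in /edge_group !act1 !eqxx. Qed.

Lemma edge_groupV u v : invg_closed (edge_group u v).
Proof.
move=> g; rewrite !unfold_in /edge_group.
case/orP=> /andP[/eqP gu /eqP gv]; have := actK g u; have := actK g v;
  by rewrite gu gv => -> ->; rewrite !eqxx ?orbT.
Qed.

HB.instance Definition _ u v :=
  isMulClosed.Build G (edge_group u v) (@edge_groupM u v).
HB.instance Definition _ u v :=
  isMul1Closed.Build G (edge_group u v) (edge_group1 u v).
HB.instance Definition _ u v :=
  isInvClosed.Build G (edge_group u v) (@edge_groupV u v).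

End Stabilisers.

End Groups.

Section RelativeBoundary.
Variable R : realType.

Definition cayley_space (G : groupType) (S : generators G) : metricType R :=
  realization R (cayley_graph S).

Definition group_point (G : groupType) (S : generators G) (g : G) :
  cayley_space S := vertex_point R (g : vertex (cayley_graph S)).

Definition group_morse_boundary (G : groupType) (S : generators G) :
  topologicalType := morse_boundary (group_point S 1%g).

Variables (G : groupType) (S : generators G).

(* The choices made in a relative Morse boundary: a generating set of H and a
   quasi-isometric embedding extending the inclusion. *)
Record cayley_embedding (H : groupClosed G) := CayleyEmbedding {
  sub_gens : generators (subgroup H);
  emb :> cayley_space sub_gens -> cayley_space S;
  emb_group_point : forall h : subgroup H,
    emb (group_point sub_gens h) = group_point S (\val h);
  emb_qi : qi_embedding mdist mdist emb }.

Variables (H : groupClosed G) (i : cayley_embedding H).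

Definition rel_boundary : set (group_morse_boundary (sub_gens i)) :=
  [set xi | exists2 c, endpoint c = xi & morse (i @` range (\val c))].

(* The graph of the natural injection on [rel_boundary]. *)
Definition natural_injection (xi : group_morse_boundary (sub_gens i))
    (eta : group_morse_boundary S) : Prop :=
  exists c d, [/\ endpoint c = xi, endpoint d = eta &
    finite_hausdorff (range (\val d)) (i @` range (\val c))].

Definition rel_boundary_image : set (group_morse_boundary S) :=
  [set eta | exists2 xi, rel_boundary xi & natural_injection xi eta].

End RelativeBoundary.

Arguments rel_boundary {R G S H} i _.
Arguments natural_injection {R G S H} i _ _.
Arguments rel_boundary_image {R G S H} i _.

(* Main.v *)
(* Fix a vertex o and map g to g o. Passing from one side of an edge {u, v} of the
   tree to the other happens close to cosets of finitely many edge groups. As no ray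
   of an edge group E is Morse in G, compactness bounds the length of a segment of an
   N-Morse ray whose endpoints are close to one coset of E. Hence a Morse ray
   eventually stays on one side of each edge, and the side is locally constant on
   every stratum, so that each edge cuts the Morse boundary into two clopen sets and
   every component C orients all the edges of the tree.

   If all the edges at some v point to v, the excursions of a ray of C away from v
   have bounded length; the ray stays close to the stabiliser V of v and is the limit
   of geodesics of V. Otherwise one follows the orientation along an infinite ray of
   the tree. Two rays of C cross all its edges, and both pass close to the point
   nearest to 1 of each coset that they meet there; these points go to infinity, so
   the rays are asymptotic and C is a singleton.

   A ray close to two vertex groups is close to their intersection, which is contained
   in an edge group. *)

Require Import Defs.
From mathcomp Require Import all_boot all_order all_algebra.
From mathcomp Require Import all_classical all_reals.
From mathcomp Require Import topology.
From mathcomp Require Import zify ring lra.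

Set Implicit Arguments.
Unset Strict Implicit.
Unset Printing Implicit Defensive.

Import Order.TTheory GRing.Theory Num.Theory.
Import numFieldTopology.Exports.
Local Open Scope classical_set_scope.

(** * Word metrics *)

(** The estimates are made in [G], with word metrics and constants in [nat]; Cayley graphs are
    entered only to read off Morse gauges and to build rays. Bounds obtained by compactness come
    from limits over varying paths. They are therefore stated uniformly over all paths with a given
    quasi-geodesic constant and a given gauge, and this uniformity is also what makes sides locally
    constant on a stratum. The tree need not be locally finite, so uniformity over its edges has
    another source, a finite list [J]: translated back by the group element at which it is crossed,
    an edge crossed by a jump of bounded length belongs to [J]. *)

Section WordMetric.
Variables (G : groupType) (S : generators G).
Local Open Scope group_scope.

Definition wd (g h : G) : nat := word_length S (g^-1 * h).

Lemma word_lengthP (g : G) :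
  exists w, [/\ all (letters S) w, \prod_(x <- w) x = g & size w = word_length S g].
Proof. by rewrite /word_length; case: ex_minnP => n /asboolP. Qed.

Lemma word_length_le (w : seq G) :
  all (letters S) w -> (word_length S (\prod_(x <- w) x) <= size w)%N.
Proof.
by move=> Sw; rewrite /word_length; case: ex_minnP => n _; apply; apply/asboolP; exists w.
Qed.

Lemma word_length1 : word_length S 1 = 0%N.
Proof. by apply/eqP; have := @word_length_le [::] isT; rewrite big_nil leqn0. Qed.

Lemma word_lengthM (g h : G) :
  (word_length S (g * h) <= word_length S g + word_length S h)%N.
Proof.
have [w [Sw <- <-]] := word_lengthP g; have [v [Sv <- <-]] := word_lengthP h.
by rewrite -big_cat -size_cat word_length_le// all_cat Sw Sv.
Qed.

Lemma lettersV (x : G) : (x^-1 \in letters S) = (x \in letters S).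
Proof. by rewrite !inE invgK orbC. Qed.

Lemma word_lengthV_le (g : G) : (word_length S g^-1 <= word_length S g)%N.
Proof.
have [w [Sw <- <-]] := word_lengthP g.
elim: w Sw => [|x w IH] /=; first by rewrite big_nil invg1 word_length1.
case/andP=> Sx Sw; rewrite big_cons invgM (leq_trans (word_lengthM _ _))//.
rewrite -addn1 leq_add ?IH//.
have := @word_length_le [:: x^-1]; rewrite big_seq1 /= andbT; apply.
by rewrite -[letters S _]/(x^-1 \in letters S) lettersV.
Qed.

Lemma word_lengthV (g : G) : word_length S g^-1 = word_length S g.
Proof. by apply/eqP; rewrite eqn_leq word_lengthV_le -{1}[g]invgK word_lengthV_le. Qed.

Lemma wdxx g : wd g g = 0%N.
Proof. by rewrite /wd mulVg word_length1. Qed.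

Lemma wdC g h : wd g h = wd h g.
Proof. by rewrite /wd -word_lengthV invgM invgK. Qed.

Lemma wdD g h k : (wd g k <= wd g h + wd h k)%N.
Proof.
apply: leq_trans (word_lengthM _ _).
by rewrite mulgA -(mulgA g^-1) mulgV mulg1.
Qed.

Lemma wdM x g h : wd (x * g) (x * h) = wd g h.
Proof. by rewrite /wd invgM -mulgA (mulgA x^-1) mulVg mul1g. Qed.

Lemma wd1 g : wd 1 g = word_length S g.
Proof. by rewrite /wd invg1 mul1g. Qed.

Lemma wd_mul g x : wd g (g * x) = word_length S x.
Proof. by rewrite /wd mulKg. Qed.

Lemma wd_eq0 g h : wd g h = 0%N -> g = h.
Proof.
rewrite /wd; have [w [_ e <-]] := word_lengthP (g^-1 * h).
by move/size0nil => w0; move: e; rewrite w0 big_nil => e; rewrite -[h](mulVKg g) -e mulg1.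
Qed.

Lemma word_length0 g : word_length S g = 0%N -> g = 1.
Proof. by rewrite -wd1 => /wd_eq0. Qed.

Lemma word_ball n : exists s : seq G, forall g, (word_length S g <= n)%N -> g \in s.
Proof.
elim: n => [|n [s IH]].
  by exists [:: 1] => g; rewrite leqn0 => /eqP /word_length0 ->; rewrite inE.
pose L := S ++ [seq x^-1 | x <- S].
exists (s ++ [seq x * y | x <- L, y <- s]) => g; rewrite leq_eqVlt => /orP[/eqP|]; last first.
  by rewrite ltnS => /IH; rewrite mem_cat => ->.
have [[|x w] [Sw <- e1]] := word_lengthP g; first by rewrite -e1.
move=> e2; rewrite mem_cat big_cons; apply/orP; right; case/andP: Sw => Sx Sw.
apply: allpairs_f; last first.
  apply: IH; rewrite (leq_trans (word_length_le Sw))//.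
  by move: e1; rewrite e2 /= => -[->].
rewrite mem_cat; case/orP: Sx => Sx; first by rewrite Sx.
by apply/orP; right; apply/mapP; exists x^-1; rewrite ?invgK.
Qed.

(** Constant after its end, so that geodesics to different targets are all sequences on [nat] and
    can be fed to [konig]. *)
Lemma word_geodesic g : exists p : nat -> G,
  [/\ p 0%N = 1, forall n, (word_length S g <= n)%N -> p n = g &
   forall i j, (i <= j <= word_length S g)%N -> wd (p i) (p j) = (j - i)%N].
Proof.
have [w [Sw e sw]] := word_lengthP g.
pose p i := \prod_(x <- take i w) x.
have p1 i j : (i <= j)%N -> (wd (p i) (p j) <= j - i)%N.
  move=> ij; rewrite /p -(subnKC ij) takeD big_cat wd_mul.
  apply: leq_trans (word_length_le _) _; last by rewrite size_take_min; lia.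
  by move: Sw; rewrite -{1}(cat_take_drop i w) all_cat => /andP[_];
     rewrite -{1}(cat_take_drop (j - i) (drop i w)) all_cat => /andP[].
exists p; split; first by rewrite /p take0 big_nil.
  by move=> n; rewrite -sw => /take_oversize; rewrite /p => ->.
move=> i j /andP[ij jn].
have p0 : p 0%N = 1 by rewrite /p take0 big_nil.
have pn : p (word_length S g) = g by rewrite /p -sw take_size.
have h0 := p1 0%N i (leq0n _); have h2 := p1 j _ jn; have h1 := p1 _ _ ij.
have h3 := wdD 1 (p i) g; have h4 := wdD (p i) (p j) g.
rewrite wd1 in h3; rewrite p0 in h0; rewrite pn in h2; lia.
Qed.

End WordMetric.

(** * Discrete quasi-geodesics and Morse paths *)

(** Bounding the upward jumps alone suffices: just before [f] first exceeds [x], it is at most [B]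
    below [x]. *)
Lemma nat_ivt (B : nat) (f : nat -> nat) (x i j : nat) : (i <= j)%N ->
  (forall k, i <= k < j -> f k.+1 <= f k + B)%N -> (f i <= x <= f j)%N ->
  exists k, [/\ (i <= k <= j)%N, (f k <= x)%N & (x <= f k + B)%N].
Proof.
move=> ij; rewrite -(subnKC ij); elim: (j - i)%N => [|m IH] fB /andP[fi fj].
  by exists i; rewrite addn0 in fj *; split; lia.
have [fm|fm] := leqP x (f (i + m)%N).
  have [||k [? ? ?]] := IH _ _.
  - by move=> k ?; apply: fB; lia.
  - by lia.
  - by exists k; split=> //; lia.
exists (i + m)%N; split; try lia.
by have := fB (i + m)%N; rewrite -addnS; lia.
Qed.

Section QuasiPath.
Variables (G : groupType) (S : generators G).
Local Notation d := (wd S).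

(* The lower bound of a quasi-geodesic is multiplied out, to stay in [nat]. *)
Definition quasi_path (C n : nat) (q : nat -> G) : Prop :=
  forall i j, (i <= j <= n)%N ->
    (j - i <= C * d (q i) (q j) + C)%N /\ (d (q i) (q j) <= C * (j - i) + C)%N.

Definition dmorse_at (C M : nat) (A : set G) : Prop :=
  forall n q, quasi_path C n q -> A (q 0%N) -> A (q n) ->
    forall i, (i <= n)%N -> exists2 x, A x & (d (q i) x <= M)%N.

Definition dmorse (N : nat -> nat) (A : set G) : Prop :=
  forall C, dmorse_at C (N C) A.

Lemma quasi_path_rev C n q :
  quasi_path C n q -> quasi_path C n (fun i => q (n - i)%N).
Proof.
move=> h i j ij; have := h (n - j)%N (n - i)%N.
by rewrite (_ : n - i - (n - j) = j - i)%N; [rewrite (wdC S (q (n - i)%N)); apply; lia|lia].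
Qed.

Lemma quasi_pathM C n x q :
  quasi_path C n q -> quasi_path C n (fun i => (x * q i)%g).
Proof. by move=> h i j ij; rewrite wdM; exact: h. Qed.

Lemma dmorseM N x (A : set G) :
  dmorse N A -> dmorse N [set (x * y)%g | y in A].
Proof.
move=> h C n q qC [y0 A0 e0] [yn An en] i ni.
have [||y Ay dy] := h C n _ (quasi_pathM x^-1 qC) _ _ _ ni.
- by rewrite -e0 mulKg.
- by rewrite -en mulKg.
- by exists (x * y)%g; [exists y | rewrite -(wdM S x) mulVKg in dy].
Qed.

(** The Morse condition wants endpoints exactly on the set; a path that ends near it gets one more
    point at each end, which moves [q i] to index [i.+1]. *)
Definition extend (x y : G) (n : nat) (q : nat -> G) (i : nat) : G :=
  if i == 0%N then x else if (i <= n.+1)%N then q i.-1 else y.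

Lemma extend_near x y n q K i : (d (q 0%N) x <= K)%N -> (d (q n) y <= K)%N ->
  (i <= n.+2)%N -> (d (extend x y n q i) (q (minn i.-1 n)) <= K)%N.
Proof.
move=> h0 hn ni; rewrite /extend; case: eqP => [->|i0]; first by rewrite min0n wdC.
case: (leqP i n.+1) => i1; first by rewrite (minn_idPl _) ?wdxx; lia.
by rewrite (minn_idPr _) 1?wdC; lia.
Qed.

(** Distances change by at most [2 * K] and parameter differences by at most 2. The lower bound then
    needs [2 * K * C + C + 2], the upper one [C + 2 * K]. *)
Definition ext_cst (K C : nat) : nat := (2 * K * C + C + 2 * K + 2)%N.

Lemma quasi_path_extend C n q x y K : quasi_path C n q ->
  (d (q 0%N) x <= K)%N -> (d (q n) y <= K)%N ->
  quasi_path (ext_cst K C) n.+2 (extend x y n q).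
Proof.
move=> h h0 hn i j ij; rewrite /ext_cst.
have hi := @extend_near x y n q K i h0 hn; have hj := @extend_near x y n q K j h0 hn.
have hij := h (minn i.-1 n) (minn j.-1 n).
have t1 := wdD S (extend x y n q i) (q (minn i.-1 n)) (extend x y n q j).
have t2 := wdD S (q (minn i.-1 n)) (q (minn j.-1 n)) (extend x y n q j).
have t3 := wdD S (q (minn i.-1 n)) (extend x y n q i) (q (minn j.-1 n)).
have t4 := wdD S (extend x y n q i) (extend x y n q j) (q (minn j.-1 n)).
rewrite (wdC S (q (minn i.-1 n)) (extend x y n q i)) in t3.
rewrite (wdC S (q (minn j.-1 n)) (extend x y n q j)) in t2.
have {}hi : (d (extend x y n q i) (q (minn i.-1 n)) <= K)%N by apply: hi; lia.
have {}hj : (d (extend x y n q j) (q (minn j.-1 n)) <= K)%N by apply: hj; lia.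
have [|h1 h2] := hij _; first by lia.
move: (d (extend x y n q i) (extend x y n q j)) t1 t2 t3 t4 => e t1 t2 t3 t4.
have {h hij h0 hn hi hj} : (e <= d (q (minn i.-1 n)) (q (minn j.-1 n)) + 2 * K
   /\ d (q (minn i.-1 n)) (q (minn j.-1 n)) <= e + 2 * K)%N by lia.
move: (d _ _) h1 h2 => e' h1 h2 [h3 h4].
have h5 : (j - i <= minn j.-1 n - minn i.-1 n + 2)%N by lia.
have h6 : (minn j.-1 n - minn i.-1 n <= j - i)%N by lia.
move: (minn j.-1 n - minn i.-1 n)%N h5 h6 h1 h2 => z h5 h6 h1 h2.
have p1 : (C * e' <= C * e + 2 * K * C)%N by nia.
have p2 : (C * e <= (2 * K * C + C + 2 * K + 2) * e)%N by rewrite leq_mul2r; lia.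
have p3 : (C * z <= C * (j - i))%N by rewrite leq_mul2l h6 orbT.
have p4 : (C * (j - i) <= (2 * K * C + C + 2 * K + 2) * (j - i))%N by rewrite leq_mul2r; lia.
by split; lia.
Qed.

Lemma dmorse_near N A C K n q x y : dmorse N A -> quasi_path C n q -> A x -> A y ->
  (d (q 0%N) x <= K)%N -> (d (q n) y <= K)%N ->
  forall i, (i <= n)%N -> exists2 z, A z & (d (q i) z <= N (ext_cst K C))%N.
Proof.
move=> mA qC Ax Ay h0 hn i ni.
have [|||z Az hz] := mA _ _ _ (quasi_path_extend qC h0 hn) _ _ i.+1 _.
- exact: Ax.
- by rewrite /extend /= ltnn.
- by lia.
- by exists z => //; move: hz; rewrite /extend /= ltnS ni.
Qed.

Definition morse_path (A : nat) (N : nat -> nat) (g : nat -> G) : Prop :=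
  (forall n, quasi_path A n g) /\ dmorse N (range g).

Lemma morse_pathM A N x g :
  morse_path A N g -> morse_path A N (fun i => (x * g i)%g).
Proof.
case=> h1 h2; split; first by move=> n; exact/quasi_pathM.
by have := dmorseM (x := x) h2; rewrite image_comp.
Qed.

(* Along [q] the parameter of a nearby point of [g] moves by bounded steps, so the
   discrete intermediate value theorem applies to it: it meets every [r] between
   [s] and [t], and if it leaves this interval it must come back. *)
Lemma morse_segment A N C K : exists M, forall g n q s t,
  morse_path A N g -> quasi_path C n q -> (s <= t)%N ->
  (d (q 0%N) (g s) <= K)%N -> (d (q n) (g t) <= K)%N ->
  (forall i, (i <= n)%N -> exists2 r, (s <= r <= t)%N & (d (q i) (g r) <= M)%N) /\
  (forall r, (s <= r <= t)%N -> exists2 i, (i <= n)%N & (d (q i) (g r) <= M)%N).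
Proof.
(* [B] bounds the upward jumps of the parameter [r], and [M1] the distance from [q' k] to [g x] when
   [r k <= x <= r k + B]. *)
pose C' := ext_cst K C; pose M0 := N C'.
pose B := (A * (2 * M0 + 2 * C') + A)%N; pose M1 := (A * B + A + M0)%N.
exists (C' * (C' * M1 + C') + C' + M1 + 2 * K)%N.
move=> g n q s t [gA gN] qC st h0 hn.
have qC' := quasi_path_extend qC h0 hn.
set q' := extend _ _ _ _ in qC'.
have q'0 : q' 0%N = g s by [].
have q'n : q' n.+2 = g t by rewrite /q' /extend /= ltnn.
have q'q i : (i <= n.+2)%N -> (d (q' i) (q (minn i.-1 n)) <= K)%N.
  by move=> ni; exact: extend_near.
have q'S i : (i <= n)%N -> q' i.+1 = q i by move=> ni; rewrite /q' /extend /= ltnS ni.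
have [r [r0 rn rP]] : exists r : nat -> nat, [/\ r 0%N = s, r n.+2 = t &
    forall i, (i <= n.+2)%N -> (d (q' i) (g (r i)) <= M0)%N].
  have ex i : exists r, (i <= n.+2)%N ->
      [/\ i = 0%N -> r = s, i = n.+2 -> r = t & (d (q' i) (g r) <= M0)%N].
    have [->|i0] := eqVneq i 0%N; first by exists s; rewrite q'0 wdxx.
    have [->|i1] := eqVneq i n.+2; first by exists t; rewrite q'n wdxx.
    have [ni|ni] := leqP i n.+2; last by exists 0%N.
    have [||_ [r _ <-] dr] := gN _ _ _ qC' _ _ _ ni.
    - by rewrite q'0; exists s.
    - by rewrite q'n; exists t.
    - by exists r => _; split=> // /eqP e; rewrite ?(negPf i0) ?(negPf i1) in e.
  have [r rP] := choice ex.
  exists r; split; [by have [+ _ _] := rP 0%N isT; apply|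
    by have [_ + _] := rP _ (leqnn n.+2); apply|by move=> i /rP[]].
have gd i j : (j - i <= A * d (g i) (g j) + A)%N.
  have [ij|/ltnW ji] := leqP i j; last by rewrite (_ : j - i = 0)%N; lia.
  by have [] := gA j i j; rewrite ?ij ?leqnn.
have gl i j : (d (g i) (g j) <= A * (i - j) + A * (j - i) + A)%N.
  have [ij|/ltnW ji] := leqP i j; last rewrite wdC.
    by have [] := gA j i j; rewrite ?ij ?leqnn//; lia.
  by have [] := gA i j i; rewrite ?ji ?leqnn//; lia.
have rstep i : (i <= n.+1)%N -> (d (g (r i)) (g (r i.+1)) <= 2 * M0 + 2 * C')%N.
  move=> ni; have h1 := rP i (leqW ni); have h2 := rP i.+1 ni.
  have [|_ h3] := qC' i i.+1 _; first by rewrite leqnSn.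
  have := wdD S (g (r i)) (q' i) (g (r i.+1)); have := wdD S (q' i) (q' i.+1) (g (r i.+1)).
  rewrite (wdC _ (g (r i)) (q' i)) -/C' in h3 *; lia.
have rup i : (i < n.+2)%N -> (r i.+1 <= r i + B)%N.
  by move=> ni; have := rstep i ni; have := gd (r i) (r i.+1); rewrite /B; nia.
have close k x : (k <= n.+2)%N -> (r k <= x)%N -> (x <= r k + B)%N -> (d (q' k) (g x) <= M1)%N.
  move=> kn h1 h2; have h3 := wdD S (q' k) (g (r k)) (g x).
  have := rP k kn; have := gl (r k) x; rewrite /M1; nia.
split; last first.
  move=> x xst; have [||k [k1 k2 k3]] := @nat_ivt B r x 0 n.+2 (leq0n _) _ _.
  - by move=> k kn; apply: rup; lia.
  - by rewrite r0 rn.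
  exists (minn k.-1 n); first by lia.
  have h1 := close _ _ k1 k2 k3; have h2 := q'q _ k1.
  have := wdD S (q (minn k.-1 n)) (q' k) (g x); rewrite (wdC S _ (q' k)); lia.
move=> i ni; have i1 : (i.+1 <= n.+2)%N by lia.
have ri := rP _ i1; rewrite q'S// in ri.
(* Below [s], the parameter returns through [s] at some later [k], where [q' k] is [M1]-close to
   [q' 0]. Hence [k], and so [i.+1], is at most [C' * M1 + C']. The case above [t] is symmetric. *)
have [ris|ris] := ltnP (r i.+1) s.
  have [||k [k1 k2 k3]] := @nat_ivt B r s i.+1 n.+2 i1 _ _.
  - by move=> k kn; apply: rup; lia.
  - by rewrite rn; lia.
  have kn : (k <= n.+2)%N by lia.
  have h1 := close _ _ kn k2 k3.
  exists s; first by rewrite leqnn.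
  have [|h2 _] := qC' 0%N k _; first by rewrite kn.
  have [|_ h3] := qC' 0%N i.+1 _; first by lia.
  rewrite q'0 wdC subn0 -/C' in h2; rewrite q'0 wdC q'S// subn0 -/C' in h3.
  have h4 : (i.+1 <= C' * M1 + C')%N by nia.
  have h5 : (C' * i.+1 <= C' * (C' * M1 + C'))%N by rewrite leq_mul2l h4 orbT.
  lia.
have [rit|rit] := leqP (r i.+1) t; first by exists (r i.+1); [rewrite ris|rewrite /M1; lia].
have [||k [k1 k2 k3]] := @nat_ivt B r t 0%N i.+1 isT _ _.
- by move=> k kn; apply: rup; lia.
- by rewrite r0; lia.
have kn : (k <= n.+2)%N by lia.
have h1 := close _ _ kn k2 k3.
exists t; first by lia.
have [|h2 _] := qC' k n.+2 _; first by rewrite kn leqnn.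
have [|_ h3] := qC' i.+1 n.+2 _; first by lia.
rewrite q'n -/C' in h2; rewrite q'n q'S// -/C' in h3.
have h4 : (n.+2 - i.+1 <= C' * M1 + C')%N by nia.
have h5 : (C' * (n.+2 - i.+1) <= C' * (C' * M1 + C'))%N by rewrite leq_mul2l h4 orbT.
lia.
Qed.

End QuasiPath.

(** * Limits of Morse paths *)

(** A prefix is good if [p n] starts with it for arbitrarily large [n]. It has finitely many
    continuations, so one of them is good again. *)
Lemma konig (X : eqType) (p : nat -> nat -> X) (F : nat -> seq X) :
  (forall n i, p n i \in F i) ->
  exists w, forall k, exists2 n, (k <= n)%N & forall i, (i <= k)%N -> p n i = w i.
Proof.
move=> pF; pose x0 := p 0%N 0%N.
pose good s := forall k, exists2 n, (k <= n)%N &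
  forall i, (i < size s)%N -> p n i = nth x0 s i.
have step s : exists x, good s -> good (rcons s x).
  apply: contrapT => /forallNP bad.
  have gs : good s by apply: contrapT => ngs; apply: (bad x0).
  have /choice[kf kfP] x : exists k, forall n, (k <= n)%N ->
      ~ forall i, (i < size (rcons s x))%N -> p n i = nth x0 (rcons s x) i.
    have /not_implyP[_ /existsNP[k kP]] := bad x; exists k => n kn h.
    by apply: kP; exists n.
  have [n nk np] := gs (\max_(x <- F (size s)) kf x).
  apply: (kfP (p n (size s)) n).
    by apply: leq_trans nk; exact: leq_bigmax_seq.
  move=> i; rewrite size_rcons ltnS leq_eqVlt nth_rcons => /orP[/eqP ->|si].
    by rewrite ltnn eqxx.
  by rewrite si np.
have [nx nxP] := choice step.
pose W n := iter n (fun s => rcons s (nx s)) [::].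
have sW n : size (W n) = n by elim: n => //= n IH; rewrite size_rcons IH.
have gW n : good (W n).
  by elim: n => [|n IH]; [move=> k; exists k|exact: nxP].
have nW n i : (i < n)%N -> nth x0 (W n) i = nth x0 (W i.+1) i.
  elim: n => // n IH; rewrite ltnS leq_eqVlt => /orP[/eqP -> //|iln].
  by rewrite -IH//= nth_rcons sW iln.
exists (fun i => nth x0 (W i.+1) i) => k; have [n kn nP] := gW k.+1 k.
by exists n => // i ik; rewrite nP ?sW ?ltnS// nW.
Qed.

Section Limit.
Variables (G : groupType) (S : generators G) (H : groupType) (SH : generators H).
Local Notation d := (wd S).

Definition discrete_qie (C : nat) (f : H -> G) : Prop := forall x y,
  (wd SH x y <= C * d (f x) (f y) + C)%N /\ (d (f x) (f y) <= C * wd SH x y + C)%N.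

Lemma discrete_qieM C f g : discrete_qie C f -> discrete_qie C (fun x => (g * f x)%g).
Proof. by move=> h x y; rewrite wdM; exact: h. Qed.

Lemma geodesic_quasi_path C f n p : discrete_qie C f ->
  (forall i j, (i <= j <= n)%N -> wd SH (p i) (p j) = (j - i)%N) ->
  quasi_path S C n (fun i => f (p i)).
Proof. by move=> h pP i j ij; have := h (p i) (p j); rewrite pP. Qed.

(** Two-sided approximation on larger and larger balls with one error [M]: the first half carries
    points of the limit to a segment, the second brings points of the segment back. *)
Definition limit_of (g : nat -> nat -> G) (s t : nat -> nat) (M : nat)
  (f : H -> G) (w : nat -> H) := forall k, exists2 n, (k <= n)%N &
  (forall i, (i <= k)%N -> exists2 r, (s n <= r <= t n)%N & (d (f (w i)) (g n r) <= M)%N) /\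
  (forall r, (s n <= r <= t n)%N -> (d (f 1%g) (g n r) <= k)%N ->
     exists i, (d (f (w i)) (g n r) <= M)%N).

Lemma limit_path A N C K f : discrete_qie C f -> exists M, forall g s t h,
  (forall n, morse_path S A N (g n)) -> (forall n, s n <= t n)%N ->
  (forall n, n <= t n - s n)%N ->
  (forall n, d (f 1%g) (g n (s n)) <= K)%N -> (forall n, d (f (h n)) (g n (t n)) <= K)%N ->
  exists w, [/\ w 0%N = 1%g, forall i j, (i <= j)%N -> wd SH (w i) (w j) = (j - i)%N &
    limit_of g s t M f w].
Proof.
move=> fC; have [M MP] := morse_segment S A N C K.
exists M => g s t h gP st stn g1 gh.
have /choice[p pP] n := word_geodesic SH (h n).
have /choice[F FP] i := word_ball SH i.
have pF n i : p n i \in F i.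
  have [p1 pe pg] := pP n; apply: FP.
  have [ni|ni] := leqP i (word_length SH (h n)); last by rewrite pe ltnW.
  by have := pg 0%N i; rewrite p1 wd1 subn0 => ->.
have [w wP] := konig pF.
(* The segments get longer, so their ends [h n] leave every ball of [H] and the [p n] are geodesic
   on longer and longer intervals. *)
have long k n : (A * (2 * K + C * k + C) + A < n)%N -> (k <= word_length SH (h n))%N.
  move=> kn; have [h1 _] := (gP n).1 (t n) (s n) (t n) (introT andP (conj (st n) (leqnn _))).
  have h2 := wdD S (g n (s n)) (f 1%g) (g n (t n)).
  have h3 := wdD S (f 1%g) (f (h n)) (g n (t n)).
  have [_ h4] := fC 1%g (h n); rewrite wd1 in h4.
  rewrite (wdC S (g n (s n)) (f 1%g)) in h2; have := g1 n; have := gh n; have := stn n.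
  move=> h5 h6 h7; rewrite leqNgt; apply/negP => hk.
  have h8 : (d (g n (s n)) (g n (t n)) <= 2 * K + C * k + C)%N by nia.
  have h9 : (A * d (g n (s n)) (g n (t n)) <= A * (2 * K + C * k + C))%N.
    by rewrite leq_mul2l h8 orbT.
  lia.
have approx k : exists n, [/\ (k <= n)%N, forall i, (i <= k)%N -> p n i = w i &
    (k <= word_length SH (h n))%N].
  have [n nk nP] := wP (maxn k (A * (2 * K + C * k + C) + A).+1).
  exists n; split; [by lia|by move=> i ik; apply: nP; lia|].
  by apply: long; lia.
exists w; split.
- by have [n _ <-] := wP 0%N => //; have [] := pP n.
- move=> i j ij; have [n [_ nP nj]] := approx j.
  by rewrite -!nP//; have [_ _] := pP n; apply; rewrite ij.
(* A point of the segment within [k] of [f 1] is [M]-close to some [f (p n i)], which forces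
   [i <= C * (k + M) + C]; up to there [p n] agrees with [w]. *)
move=> k; have [n [nk nP nl]] := approx (maxn k (C * (k + M) + C)).
exists n; first by lia.
have [p1 pe pg] := pP n.
have [||h1 h2] := MP (g n) (word_length SH (h n)) (fun i => f (p n i)) (s n) (t n) (gP n)
  (geodesic_quasi_path fC pg) (st n).
- by rewrite p1.
- by rewrite pe.
split=> [i ik|r rst rk].
  by have [|r rst] := h1 i; [lia|rewrite nP; [exists r|lia]].
have [i ni ir] := h2 r rst; exists i.
rewrite -nP//.
have := wdD S (f 1%g) (g n r) (f (p n i)); rewrite (wdC S (g n r)).
have [+ _] := fC 1%g (p n i).
have := pg 0%N i; rewrite p1 ni subn0 => -> // h3 h4.
have : (C * d (f 1%g) (f (p n i)) <= C * (k + M))%N by rewrite leq_mul2l; lia.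
lia.
Qed.

(** A quasi-geodesic with ends on the limit stays in a ball, where the limit is [M]-close to some
    [g m]; [morse_segment] applies to [g m] with constants that do not depend on [m]. *)
Lemma limit_dmorse A N f w g s t M :
  (forall n, morse_path S A N (g n)) -> limit_of g s t M f w ->
  forall C, exists M', dmorse_at S C M' (range (fun i => f (w i))).
Proof.
move=> gP lim C; have [M1 M1P] := morse_segment S A N C M.
exists (M1 + M)%N => n q qC [a _ ea] [b _ eb] i ni.
(* The first condition carries the endpoints to [g m]; the second keeps the points of [g m] found
   near [q] inside the ball from which one can return to the limit. *)
have [k k0 kP] : exists2 k, (maxn a b <= k)%N &
    forall i, (i <= n)%N -> (d (f 1%g) (q i) + M1 <= k)%N.
  exists (maxn (maxn a b) (d (f 1%g) (q 0%N) + (C * n + C) + M1)); first by lia.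
  move=> j jn; have := wdD S (f 1%g) (q 0%N) (q j).
  have [|_] := qC 0%N j; first by rewrite jn.
  have : (C * (j - 0) <= C * n)%N by rewrite leq_mul2l; lia.
  lia.
have [m km [h1 h2]] := lim k.
have [|r rst ra] := h1 a; first by lia.
have [|r' rst' ra'] := h1 b; first by lia.
have ends j x : (j <= n)%N -> (s m <= x <= t m)%N -> (d (q j) (g m x) <= M1)%N ->
    exists2 z, range (fun i => f (w i)) z & (d (q j) z <= M1 + M)%N.
  move=> jn xst xj; have [|y yx] := h2 x xst _.
  - by have := kP j jn; have := wdD S (f 1%g) (q j) (g m x); lia.
  - exists (f (w y)); first by exists y.
    by have := wdD S (q j) (g m x) (f (w y)); rewrite (wdC S (g m x)); lia.
(* The order of the two parameters on [g m] is not controlled, so [q] may have to be traversed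
   backwards. *)
have [rr|/ltnW rr] := leqP r r'.
  have [||/(_ i ni)[x xr xi] _] := M1P (g m) n q r r' (gP m) qC rr.
  - by rewrite -ea.
  - by rewrite -eb.
  by apply: ends xi => //; lia.
have [||/(_ (n - i)%N (leq_subr _ _))[x xr xi] _] := M1P (g m) n _ r' r (gP m) (quasi_path_rev qC) rr.
- by rewrite subn0 -eb.
- by rewrite subnn -ea.
by rewrite subKn// in xi; apply: ends xi => //; lia.
Qed.

(* [m] is a point of the coset nearest to 1: a geodesic from 1 to [m] followed by a
   geodesic of the coset is a quasi-geodesic. *)
Lemma coset_projection C (f : H -> G) : discrete_qie C f -> f 1%g = 1%g ->
  (forall x y, f (x * y)%g = (f x * f y)%g) -> forall g, exists m,
  [/\ exists e, m = (g * f e)%g, forall e, (word_length S m <= word_length S (g * f e))%N &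
   forall e, exists n q, [/\ quasi_path S (2 * C + 1) n q, q 0%N = 1%g, q n = (g * f e)%g &
     exists2 i, (i <= n)%N & q i = m]].
Proof.
move=> fC f1 fM g.
have exm : exists n : nat, `[< exists e, word_length S (g * f e)%g = n >].
  by exists (word_length S (g * f 1%g)%g); apply/asboolP; exists 1%g.
have [l0 /asboolP[e0 el] lmin] := ex_minnP exm.
pose m := (g * f e0)%g; exists m; split; first by exists e0.
  by move=> e; rewrite /m el; apply: lmin; apply/asboolP; exists e.
move=> e; have [p [p0 pe pg]] := word_geodesic S m.
have [u [u0 ue ug]] := word_geodesic SH (e0^-1 * e)%g.
pose l := word_length S m; pose l' := word_length SH (e0^-1 * e)%g.
pose q i := if (i <= l)%N then p i else (m * f (u (i - l)%N))%g.
have ql i : (l <= i)%N -> q i = (m * f (u (i - l)%N))%g.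
  rewrite /q leq_eqVlt => /orP[/eqP <-|li]; first by rewrite leqnn subnn u0 f1 mulg1 pe.
  by rewrite leqNgt li.
have mC : discrete_qie C (fun x => (m * f x)%g) := discrete_qieM m fC.
exists (l + l')%N, q; split.
- move=> i j /andP[ij jn].
  have [jl|jl] := leqP j l.
    rewrite /q (leq_trans ij jl) jl pg ?ij//; nia.
  have [il|li] := leqP i l; last first.
    rewrite !ql; try lia.
    have := @geodesic_quasi_path _ _ l' u mC ug (i - l)%N (j - l)%N.
    rewrite (_ : j - l - (i - l) = j - i)%N; last by lia.
    move=> []; first by lia.
    by move=> h1 h2; split; nia.
  have qi : q i = p i by rewrite /q il.
  rewrite (ql j (ltnW jl)) qi.
  set y := (m * _)%g; have h1 : d (p i) m = (l - i)%N by rewrite -(pe l) // pg ?il /=.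
  have [h2 h3] := mC 1%g (u (j - l)%N); rewrite f1 mulg1 -/y wd1 in h2 h3.
  have h0 : word_length SH (u (j - l)%N) = (j - l)%N.
    by rewrite -[LHS](wd1 SH) -u0 ug ?subn0//; lia.
  rewrite h0 in h2 h3.
  (* By the choice of [m], the point [y] is at least as far from [p i] as [m] is, hence
     [d m y <= 2 * d (p i) y]. This is the origin of the constant [2 * C + 1]. *)
  have h4 : (l <= word_length S y)%N.
    by rewrite /l /m el; apply: lmin; apply/asboolP; exists (e0 * u (j - l)%N)%g; rewrite fM mulgA.
  have h5 := wdD S 1%g (p i) y; rewrite !wd1 in h5.
  have h6 : word_length S (p i) = i by rewrite -[LHS](wd1 S) -p0 pg ?subn0.
  have h7 := wdD S m (p i) y; rewrite (wdC S m (p i)) h1 in h7.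
  have h8 := wdD S (p i) m y; rewrite h1 in h8.
  have h9 : (C * d m y <= C * (2 * d (p i) y))%N by rewrite leq_mul2l; lia.
  have h10 : (C * (j - l) <= C * (j - i))%N by rewrite leq_mul2l; lia.
  by split; lia.
- by rewrite /q p0.
- rewrite ql; last by lia.
  by rewrite addKn ue// /m -mulgA -fM mulVKg.
- by exists l; [lia|rewrite /q leqnn pe].
Qed.

End Limit.

(** * Cayley graphs as metric spaces *)

Section Realization.
Variables (R : realType) (K : cgraph).
Local Open Scope ring_scope.

Lemma segment_sum (D : vertex K -> R) u v t : u = v \/ adj u v ->
  \sum_(w \in [set: vertex K]) segment u v t w * D w = (1 - t) * D u + t * D v.
Proof.
case=> [->|uv].
  rewrite (fsbigE [:: v])//=; last first.
    by move=> w _; rewrite inE /segment => /negPf ->; rewrite !mulr0 addr0 mul0r.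
  by rewrite (eq_bigl xpredT) => [|i]; [rewrite big_seq1 /segment eqxx /=; ring|exact/mem_set].
have unv : u != v by apply: contraTneq uv => ->; rewrite adj_irr.
rewrite (fsbigE [:: u; v])//=; first last.
- move=> w _; rewrite !inE negb_or /segment => /andP[/negPf -> /negPf ->].
  by rewrite !mulr0 addr0 mul0r.
- by rewrite inE unv.
rewrite (eq_bigl xpredT) => [|i]; last exact/mem_set.
rewrite big_cons big_seq1 /segment !eqxx (negPf unv) eq_sym (negPf unv) /=; ring.
Qed.

(* 1-Lipschitz functions give the lower bounds on [rdist]. *)
Lemma lipschitz_extension (D : vertex K -> R) :
  (forall u v, adj u v -> `|D u - D v| <= 1) ->
  exists F : realization R K -> R,
    (forall x u v t, u = v \/ adj u v -> Defs.coord x = segment u v t ->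
       F x = (1 - t) * D u + t * D v) /\
    (forall x y, `|F x - F y| <= rdist x y).
Proof.
move=> DL; exists (fun x => \sum_(w \in [set: vertex K]) Defs.coord x w * D w).
split=> [x u v t uv ->|x y]; first exact: segment_sum.
apply: rdist_ge => l; elim=> [|y' z l' u v s t _ IH uv s1 t1 ey ez].
  by rewrite subrr normr0.
rewrite (le_trans (ler_distD (\sum_(w \in setT) Defs.coord y' w * D w) _ _))// lerD//.
rewrite ey ez !segment_sum; try by right.
rewrite (_ : _ - _ = (t - s) * (D u - D v)); last by ring.
by rewrite normrM distrC ler_piMr// DL.
Qed.

Lemma rdist_segment (x y : realization R K) u v s t : adj u v -> 0 <= s <= 1 -> 0 <= t <= 1 ->
  Defs.coord x = segment u v s -> Defs.coord y = segment u v t -> rdist x y <= `|s - t|.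
Proof.
by move=> uv s1 t1 ex ey; rewrite -[leRHS]add0r; apply: rdist_le;
  apply: chain_step (chain_nil _) uv s1 t1 ex ey.
Qed.

Lemma rdist_near_vertex (x : realization R K) :
  exists u, rdist x (vertex_point R u) <= 1.
Proof.
have [u [v [t [uv t1 e]]]] := coordP x; exists u.
case: uv => [uv|uv].
  suff -> : x = vertex_point R u by rewrite rdistxx.
  by apply: coord_inj; rewrite e uv /= segmentxx.
have := @rdist_segment x (vertex_point R u) u v t 0 uv t1.
rewrite lexx ler01 /= segment0 subr0 => /(_ isT e erefl) /le_trans; apply.
by case/andP: t1 => t0 t1; rewrite ger0_norm.
Qed.

End Realization.

Section CayleySpace.
Variables (R : realType) (G : groupType) (S : generators G).
Local Open Scope ring_scope.
Local Notation X := (cayley_space R S).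
Local Notation gp := (group_point R S).

Lemma mdist_mul_word g w : all (letters S) w ->
  mdist (gp g) (gp (g * \prod_(x <- w) x)%g) <= (size w)%:R.
Proof.
elim: w g => [|x w IH] g /=; first by rewrite big_nil mulg1 mdistxx.
case/andP=> Sx Sw; rewrite big_cons mulgA -natr1 addrC.
apply: le_trans (metric_triangle _ (gp (g * x)%g) _) _; apply: lerD (IH _ Sw).
have [<-|gx] := eqVneq g (g * x)%g; first by rewrite mdistxx ler01.
have adjx : adj (g : vertex (cayley_graph S)) (g * x)%g.
  by rewrite /= /cayley_adj gx mulKg.
rewrite -[leRHS]normr1 -[X in `|X|](opprK 1) normrN -[X in `|X|]add0r.
apply: rdist_segment adjx _ _ _ _; rewrite ?lexx ?ler01//=.
- by rewrite segment0.
- by rewrite segment1.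
Qed.

Lemma adj_wd (g h : vertex (cayley_graph S)) : adj g h -> (wd S g h <= 1)%N.
Proof.
move=> /andP[_ gh]; have := @word_length_le _ S [:: (g^-1 * h)%g].
by rewrite big_seq1 /= andbT; apply.
Qed.

Lemma wd_extension g : exists F : X -> R,
  (forall x (u v : vertex (cayley_graph S)) t, u = v \/ adj u v -> Defs.coord x = segment u v t ->
     F x = (1 - t) * (wd S g u)%:R + t * (wd S g v)%:R) /\
  (forall x y, `|F x - F y| <= mdist x y).
Proof.
apply: lipschitz_extension => u v uv; have h1 := adj_wd uv.
have h2 := wdD S g u v; have h3 := wdD S g v u; rewrite (wdC S v) in h3.
have a : (wd S g u)%:R <= (wd S g v)%:R + 1 :> R by rewrite natr1 ler_nat; lia.
have b : (wd S g v)%:R <= (wd S g u)%:R + 1 :> R by rewrite natr1 ler_nat; lia.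
by rewrite ler_norml; apply/andP; split; lra.
Qed.

Lemma mdist_group_point g h : mdist (gp g) (gp h) = (wd S g h)%:R.
Proof.
apply/eqP; rewrite eq_le; apply/andP; split.
  have [w [Sw ew sw]] := word_lengthP S (g^-1 * h)%g; rewrite /wd -sw.
  by have := mdist_mul_word g Sw; rewrite ew mulVKg.
have [F [FE FL]] := wd_extension g.
have := FL (gp g) (gp h); rewrite (FE (gp g) g g 0 (or_introl erefl) erefl).
rewrite (FE (gp h) h h 0 (or_introl erefl) erefl).
by rewrite wdxx !mulr0 !mul0r subr0 !mul1r !addr0 sub0r normrN normr_nat.
Qed.

(** The second clause makes rounding exact at group elements, so that discretised rays start at 1
    itself. *)
Lemma rounding_ex (x : X) : exists g,
  mdist x (gp g) <= 1 /\ forall h, x = gp h -> g = h.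
Proof.
have [[h ->]|nh] := pselect (exists h, x = gp h).
  exists h; split; first by rewrite mdistxx ler01.
  move=> k e; apply: (@wd_eq0 _ S); apply/eqP; rewrite -(eqr_nat R) -mdist_group_point e.
  by rewrite mdistxx.
have [g gx] := rdist_near_vertex x; exists g; split=> // h e.
by case: nh; exists h.
Qed.

Definition rounding (x : X) : G := sval (cid (rounding_ex x)).

Lemma mdist_rounding x : mdist x (gp (rounding x)) <= 1.
Proof. by rewrite /rounding; case: cid => /= g []. Qed.

Lemma rounding_group_point g : rounding (gp g) = g.
Proof. by rewrite /rounding; case: cid => /= h [_]; apply. Qed.

Local Notation halfline := (set_type [set t : R | 0 <= t]).

Lemma ray_of_path (w : nat -> G) : w 0%N = 1%g ->
  (forall i j, (i <= j)%N -> wd S (w i) (w j) = (j - i)%N) ->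
  exists c : halfline -> X, geodesic_ray (gp 1%g) c /\
    forall t, mdist (c t) (gp (w (Num.truncn (\val t)))) <= 1.
Proof.
move=> w0 wP; pose k (t : halfline) := Num.truncn (\val t).
have kP (t : halfline) : (k t)%:R <= \val t < (k t).+1%:R.
  by apply: truncn_itv; case: t => /= t /set_mem.
have adjw i : adj (w i : vertex (cayley_graph S)) (w i.+1).
  have := wP i i.+1 (leqnSn i); rewrite subSnn => wi.
  rewrite /= /cayley_adj; apply/andP; split.
    by apply/eqP => e; rewrite e wdxx in wi.
  have [u [Su eu su]] := word_lengthP S ((w i)^-1 * w i.+1)%g.
  rewrite -/(wd S _ _) wi in su; case: u su Su eu => [|x [|]] //= _.
  by rewrite andbT big_seq1 => Sx <-.
have frac t : 0 <= \val t - (k t)%:R <= 1.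
  by have := kP t; rewrite -natr1 => /andP[? ?]; apply/andP; split; lra.
have /choice[c cP] (t : halfline) : exists x : X,
    Defs.coord x = segment (w (k t) : vertex (cayley_graph S)) (w (k t).+1) (\val t - (k t)%:R).
  have ex : exists u v s, [/\ u = v \/ adj u v, 0 <= s <= 1 &
      segment (w (k t) : vertex (cayley_graph S)) (w (k t).+1) (\val t - (k t)%:R)
      = segment u v s].
    by exists (w (k t)), (w (k t).+1), (\val t - (k t)%:R); split=> //; right.
  by exists (Realization ex).
have c0 t : mdist (c t) (gp (w (k t))) <= \val t - (k t)%:R.
  have := @rdist_segment R _ (c t) (gp (w (k t))) _ _ _ 0 (adjw (k t)) (frac t).
  rewrite lexx ler01 subr0 ger0_norm; last by case/andP: (frac t).
  by apply=> //=; rewrite segment0.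
have c1 t : mdist (c t) (gp (w (k t).+1)) <= (k t).+1%:R - \val t.
  have := @rdist_segment R _ (c t) (gp (w (k t).+1)) _ _ _ 1 (adjw (k t)) (frac t).
  rewrite lexx ler01 distrC ger0_norm; last by case/andP: (frac t) => *; lra.
  rewrite -natr1 opprB addrCA addrA => h; apply: h => //=.
  by rewrite segment1.
have upper s t : \val s <= \val t -> mdist (c s) (c t) <= \val t - \val s.
  move=> st; have kst : (k s <= k t)%N by exact: le_truncn.
  move: kst; rewrite leq_eqVlt => /orP[/eqP e|kst].
    have ft := frac t; have ct := cP t; rewrite -e in ft ct.
    apply: le_trans (rdist_segment (adjw (k s)) (frac s) ft (cP s) ct) _.
    by rewrite opprB addrA subrK distrC ger0_norm// subr_ge0.
  rewrite (le_trans (metric_triangle _ (gp (w (k s).+1)) _))//.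
  have h1 := metric_triangle (gp (w (k s).+1)) (gp (w (k t))) (c t).
  have h2 := c1 s; have h3 := c0 t; rewrite metric_sym in h3.
  rewrite mdist_group_point wP// in h1.
  rewrite natrB// in h1.
  lra.
(* The distance to 1, extended affinely over edges, is 1-Lipschitz and takes the value [\val t] at
   [c t]: this is the lower bound on distances along [c]. *)
have [F [FE FL]] := wd_extension 1%g.
have Fc t : F (c t) = \val t.
  rewrite (FE _ _ _ _ _ (cP t)); last by right.
  have W i : wd S 1%g (w i) = i by rewrite -w0 wP// subn0.
  by rewrite !W -natr1; ring.
exists c; split; last first.
  by move=> t; apply: le_trans (c0 t) _; case/andP: (frac t).
split=> [t t0|s t].
  apply: mdist_positivity; apply/eqP; rewrite eq_le mdist_ge0 andbT.
  by have := c0 t; rewrite /k t0 truncn0 subr0 w0.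
apply/eqP; rewrite eq_le -{2}(Fc s) -{2}(Fc t) FL andbT.
have [st|/ltW ts] := leP (\val s) (\val t).
  by rewrite distrC ger0_norm ?subr_ge0 ?upper.
by rewrite metric_sym ger0_norm ?subr_ge0 ?upper.
Qed.

End CayleySpace.

(** * Morse conditions in the Cayley graph and in the word metric *)

Section Transfer.
Variables (R : realType) (G : groupType) (S : generators G).
Local Open Scope ring_scope.
Local Notation X := (cayley_space R S).
Local Notation gp := (group_point R S).

(** The infimum need not be attained, whence the extra 1; over the empty set it takes the default
    value 0, whence the nonemptiness. *)
Lemma neighbourhoodP (A : set X) r x : A !=set0 -> neighbourhood A r x ->
  exists2 y, A y & mdist x y <= r + 1.
Proof.
move=> [a Aa] h; have hi : has_inf [set mdist x y | y in A].
  split; first by exists (mdist x a), a.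
  by exists 0 => _ [y _ <-]; exact: mdist_ge0.
have [_ [y Ay <-] hy] := inf_adherent (ltr01 : 0 < 1 :> R) hi.
by exists y => //; rewrite (le_trans (ltW hy))// lerD2r.
Qed.

Lemma near_neighbourhood (A : set X) r x y : A y -> mdist x y <= r -> neighbourhood A r x.
Proof.
move=> Ay xy; apply: le_trans xy; apply: ge_inf; last by exists y.
by exists 0 => _ [z _ <-]; exact: mdist_ge0.
Qed.

Definition coarsely_equal (K : nat) (A : set X) (A' : set G) : Prop :=
  (forall x, A x -> exists2 g, A' g & mdist x (gp g) <= K%:R) /\
  (forall g, A' g -> exists2 x, A x & mdist x (gp g) <= K%:R).

Lemma qi_lower (C d l : R) : 1 <= C -> (C^-1 * l - C <= d) = (l <= C * (d + C)).
Proof. by move=> C1; rewrite lerBlDr ler_pdivrMl//; lra. Qed.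

(** Parameters are truncated by at most 1 and each endpoint moves by at most [K]: [2 * C + 2 * K]
    serves the upper bound, [2 * K * C + C + 1] the lower one. *)
Definition discretize_cst (K C : nat) : nat := (2 * K * C + 2 * C + 2 * K + 1)%N.

(** The 2 pays for the truncation of the gauge and for the infimum in [neighbourhood]; [K] leads
    from [A] back to [A']. *)
Definition discrete_gauge (N : R -> R) (K C : nat) : nat :=
  (Num.truncn (N (discretize_cst K C)%:R) + 2 + K)%N.

Lemma discretize_morse N K A A' : morse_with N A -> coarsely_equal K A A' ->
  dmorse S (discrete_gauge N K) A'.
Proof.
move=> NA [AA' A'A] C n q qC /A'A[x Ax xq] /A'A[y Ay yq] i ni.
pose C' : R := (discretize_cst K C)%:R.
pose f (t : R) := minn (Num.truncn t) n.
(* The path must start and end in [A], so [x] and [y] are put at the two ends of the step path given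
   by [q]. *)
pose Q t := if t == 0 then x else if t == n.+1%:R then y else gp (q (f t)).
have C'1 : 1 <= C' by rewrite ler1n /discretize_cst; lia.
have fP t : 0 <= t <= n.+1%:R -> (f t)%:R <= t <= (f t)%:R + 1.
  move=> /andP[t0 tn]; have /andP[h1 h2] := truncn_itv t0.
  rewrite /f natr1; case: (leqP (Num.truncn t) n) => h.
    by rewrite h1 ltW.
  by rewrite tn andbT; apply: le_trans h1; rewrite ler_nat ltnW.
have Qf t : 0 <= t <= n.+1%:R -> mdist (Q t) (gp (q (f t))) <= K%:R.
  move=> tn; rewrite /Q; case: eqP => [->|t0].
    by rewrite /f truncn0 min0n.
  case: eqP => [->|_]; last by rewrite mdistxx.
  by rewrite /f natrK (minn_idPr _).
have QP : quasi_geodesic C' 0 n.+1%:R Q.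
  have main s t : 0 <= s <= n.+1%:R -> 0 <= t <= n.+1%:R -> s <= t ->
      C'^-1 * (t - s) - C' <= mdist (Q s) (Q t) <= C' * (t - s) + C'.
    move=> sn tn st; have h1 := fP s sn; have h2 := fP t tn.
    have fst : (f s <= f t)%N by rewrite /f leq_min geq_minr andbT (leq_trans (geq_minl _ _))// le_truncn.
    have [|h3 h4] := qC (f s) (f t); first by rewrite fst geq_minr.
    have := metric_triangle (Q s) (gp (q (f s))) (Q t).
    have := metric_triangle (gp (q (f s))) (gp (q (f t))) (Q t).
    have := metric_triangle (gp (q (f s))) (Q s) (gp (q (f t))).
    have := metric_triangle (Q s) (Q t) (gp (q (f t))).
    rewrite (metric_sym (gp (q (f s))) (Q s)) (metric_sym (gp (q (f t))) (Q t)).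
    rewrite mdist_group_point; have := Qf s sn; have := Qf t tn.
    move: h3 h4; rewrite -!(ler_nat R) !natrD !natrM natrB// qi_lower//.
    have -> : C' = 2 * K%:R * C%:R + 2 * C%:R + 2 * K%:R + 1 :> R.
      by rewrite /C' /discretize_cst !natrD !natrM; ring.
    have := ler0n R C; have := ler0n R K.
    have := mdist_ge0 (Q s) (Q t).
    move: (wd _ _ _)%:R (mdist (Q s) (Q t)) (mdist (Q s) (gp (q (f s))))
       (mdist (Q t) (gp (q (f t)))) (f s)%:R (f t)%:R C%:R K%:R h1 h2.
    move=> {Qf fP qC C'1 C'} d D a b fs ft c k /andP[h1 h1'] /andP[h2 h2'] D0 k0 c0 h3 h4 h5 h6 h7 h8 h9 h10.
    have e1 : c * d <= c * (D + 2 * k) by apply: ler_wpM2l => //; lra.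
    have e2 : c * (ft - fs) <= c * (t - s + 1) by apply: ler_wpM2l => //; lra.
    have e3 : 0 <= c * k by apply: mulr_ge0.
    have e4 : 0 <= c * D by apply: mulr_ge0.
    have e5 : 0 <= k * D by apply: mulr_ge0.
    have e6 : 0 <= c * k * D by apply: mulr_ge0.
    have e7 : 0 <= (2 * k * c + 2 * c + 2 * k) * (2 * k * c + 2 * c + 2 * k + 1).
      by apply: mulr_ge0; lra.
    have e8 : 0 <= (2 * k * c + c + 2 * k + 1) * (t - s) by apply: mulr_ge0; lra.
    apply/andP; split; lra.
  move=> s t; rewrite /= !in_itv /= => sn tn.
  have [st|/ltW ts] := leP s t; first by rewrite distrC ger0_norm ?subr_ge0// main.
  by rewrite ger0_norm ?subr_ge0// metric_sym main.
have Q0 : Q 0 = x by rewrite /Q eqxx.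
have Qn : Q n.+1%:R = y by rewrite /Q eqxx pnatr_eq0.
(* A half-integer is neither 0 nor [n.+1], so [Q] is there the point [q i] and never [x] or [y]. *)
have [||z Az zq] := @neighbourhoodP A (N C') (Q (i%:R + 2^-1)).
- by exists x.
- apply: (NA C' 0 n.+1%:R Q) => //; rewrite ?Q0 ?Qn//.
  exists (i%:R + 2^-1) => //=; rewrite in_itv /=.
  have : i%:R <= n%:R :> R by rewrite ler_nat.
  by rewrite -(natr1 n); have := ler0n R i => *; apply/andP; split; lra.
have i0 := ler0n R i; have iS : i%:R + 1 = i.+1%:R :> R by rewrite natr1.
have iin : i.+1%:R <= n.+1%:R :> R by rewrite ler_nat.
have hh : i%:R <= (i%:R + 2^-1 : R) < i.+1%:R by apply/andP; split; lra.
have Qi : Q (i%:R + 2^-1) = gp (q i).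
  have ti : Num.truncn (i%:R + 2^-1 : R) = i by apply: truncn_def.
  by rewrite /Q /f ti (minn_idPl ni) gt_eqF ?lt_eqF//; lra.
have [g A'g gz] := AA' z Az; exists g => //.
rewrite -(ler_nat R) -mdist_group_point -Qi.
apply: le_trans (metric_triangle _ z _) _; rewrite /discrete_gauge natrD lerD//.
apply: le_trans zq _; rewrite addn2 -natr1 lerD2r.
by have := truncnS_gt (N C') => /ltW.
Qed.

Lemma morse_of_dmorse N K A A' : dmorse S N A' -> coarsely_equal K A A' -> morse A.
Proof.
move=> NA [AA' A'A].
pose c (C : R) := (Num.truncn C).+1.
pose e (C : nat) := (C * C + 2 * C + 3)%N.
(* In this order: from [q t] to the sample before it, rounding of that sample, the discrete gauge,
   and the return to [A]. *)
pose M (C : R) : R := (2 * c C + 1 + N (ext_cst K.+1 (e (c C))) + K)%:R.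
exists M => [C _|C a b q C1 ab qC Aa Ab x [t]]; first exact: ler0n.
rewrite /= in_itv /= => /andP[at_ tb] <-.
have [y A'y yq] := AA' _ Aa; have [z A'z zq] := AA' _ Ab.
have Cc : C <= (c C)%:R by apply/ltW/truncnS_gt.
have ba0 : 0 <= b - a by rewrite subr_ge0.
have /andP[n1 n2] := truncn_itv ba0.
set n := Num.truncn (b - a) in n1 n2.
(* Samples at unit steps from [a], closed by [b] at index [n.+1]: the last step may be shorter than
   1. *)
pose tau i := if (i <= n)%N then a + i%:R else b.
have tauP i j : (i <= j <= n.+1)%N ->
    [/\ a <= tau i <= b, a <= tau j <= b & (j - i)%:R - 1 <= tau j - tau i <= (j - i)%:R].
  move=> /andP[ij jn]; rewrite natrB// /tau; rewrite -natr1 in n2.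
  have i0 := ler0n R i; have ij' : i%:R <= j%:R :> R by rewrite ler_nat.
  have [jn'|jn'] := leqP j n.
    have := jn'; rewrite (leq_trans ij jn') -(ler_nat R) => jn''.
    by split; apply/andP; split; lra.
  have -> : j = n.+1 by apply/eqP; rewrite eqn_leq jn.
  rewrite -natr1; have [in'|in'] := leqP i n.
    have := in'; rewrite -(ler_nat R) => in''.
    by split; apply/andP; split; lra.
  have -> : i = n.+1 by apply/eqP; rewrite eqn_leq in' (leq_trans ij jn).
  by rewrite -natr1; split; apply/andP; split; lra.
have qc s u : a <= s <= b -> a <= u <= b -> s <= u ->
    u - s <= (c C)%:R * (mdist (q s) (q u) + (c C)%:R) /\
    mdist (q s) (q u) <= (c C)%:R * (u - s) + (c C)%:R.
  move=> sab uab su; have := qC s u; rewrite /= !in_itv /= => /(_ sab uab).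
  rewrite qi_lower// distrC ger0_norm ?subr_ge0// => /andP[h1 h2].
  have d0 := mdist_ge0 (q s) (q u); split.
    apply: le_trans h1 _; apply: ler_pM => //; lra.
  apply: le_trans h2 _; apply: lerD => //; apply: ler_wpM2r => //; lra.
have q'C : quasi_path S (e (c C)) n.+1 (fun i => rounding (q (tau i))).
  move=> i j ij; have [ti tj tij] := tauP i j ij.
  have titj : tau i <= tau j.
    have /andP[ij' jn] := ij; rewrite /tau; have [jn'|jn'] := leqP j n.
      by rewrite (leq_trans ij' jn') lerD2l ler_nat.
    by case: ifP => // in'; move: in'; rewrite -(ler_nat R); lra.
  have [h1 h2] := qc _ _ ti tj titj.
  have := mdist_rounding (q (tau i)); have := mdist_rounding (q (tau j)).
  rewrite -!(ler_nat R).
  have : (e (c C))%:R = (c C)%:R * (c C)%:R + 2 * (c C)%:R + 3 :> R.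
    by move: (c C) => k; rewrite /e !natrD !natrM; ring.
  move: (e (c C)) => E eE; rewrite !natrD !natrM eE -!(mdist_group_point R).
  set u := q (tau i) in h1 h2 *; set v := q (tau j) in h1 h2 *.
  set gu := gp (rounding u); set gv := gp (rounding v).
  have := metric_triangle u gu v; have := metric_triangle gu gv v.
  have := metric_triangle gu u gv; have := metric_triangle u v gv.
  rewrite (metric_sym gu u) (metric_sym gv v).
  have := ler0n R (c C); have := mdist_ge0 gu gv; have := mdist_ge0 u v.
  move: (mdist gu gv) (mdist u v) (mdist u gu) (mdist v gv) (c C)%:R (j - i)%:R h1 h2 tij.
  move=> {qc Cc tauP eE} d D x1 x2 k l h1 h2 /andP[h3 h4] D0 d0 k0 h5 h6 h7 h8 h9 h10.
  have e1 : k * D <= k * (d + 2) by apply: ler_wpM2l => //; lra.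
  have e2 : k * (tau j - tau i) <= k * l by apply: ler_wpM2l.
  have e3 : 0 <= k * d by apply: mulr_ge0.
  have l0 : 0 <= l by lra.
  have e4 : 0 <= k * l by apply: mulr_ge0.
  have e5 : 0 <= k * k * d by apply: mulr_ge0 => //; apply: mulr_ge0.
  have e6 : 0 <= k * k * l by apply: mulr_ge0 => //; apply: mulr_ge0.
  have e7 : 0 <= k * k by apply: mulr_ge0.
  by split; lra.
have near u v : a <= u <= b -> mdist (q u) (gp v) <= K%:R ->
    (wd S (rounding (q u)) v <= K.+1)%N.
  move=> uab uv; rewrite -(ler_nat R) -mdist_group_point -natr1 addrC.
  apply: le_trans (metric_triangle _ (q u) _) _; apply: lerD => //.
  by rewrite metric_sym mdist_rounding.
pose i := Num.truncn (t - a).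
have ta0 : 0 <= t - a by rewrite subr_ge0.
have /andP[i1 i2] := truncn_itv ta0; rewrite -/i -natr1 in i1 i2.
have ni : (i <= n)%N by apply: le_truncn; rewrite lerD2r.
have [||w A'w wq] := @dmorse_near _ S _ _ _ K.+1 _ _ _ _ NA q'C A'y A'z _ _ i (leqW ni).
- by rewrite /tau leq0n addr0; apply: near => //; rewrite lexx.
- by rewrite /tau ltnn; apply: near => //; rewrite lexx andbT.
have [v Av vw] := A'A w A'w; apply: (near_neighbourhood Av).
rewrite /tau ni in wq.
have i0 := ler0n R i.
have ai : a <= a + i%:R <= b by apply/andP; split; lra.
have tab : a <= t <= b by rewrite at_.
have ait : a + i%:R <= t by lra.
have [_ h] := qc _ _ ai tab ait.
have := metric_triangle (q t) (q (a + i%:R)) v.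
have := metric_triangle (q (a + i%:R)) (gp (rounding (q (a + i%:R)))) v.
have := metric_triangle (gp (rounding (q (a + i%:R)))) (gp w) v.
rewrite (metric_sym (gp w) v) (metric_sym (q t) (q (a + i%:R))) mdist_group_point.
have := mdist_rounding (q (a + i%:R)).
rewrite -(ler_nat R) in wq.
have -> : M C = 2 * (c C)%:R + 1 + (N (ext_cst K.+1 (e (c C))))%:R + K%:R.
  by rewrite /M; move: (c C) => k; rewrite natrD natrD natrD natrM.
have h' : (c C)%:R * (t - (a + i%:R)) <= (c C)%:R * 1 by apply: ler_wpM2l => //; lra.
lra.
Qed.

End Transfer.

(** * Half-trees *)

Section Sides.
Variable T : cgraph.
Implicit Types u v x y : vertex T.

Definition off_edge u v x y : bool :=
  adj x y && ~~ ((x == u) && (y == v) || (x == v) && (y == u)).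

(* The vertices on the side of [v] when the edge {u, v} is removed. *)
Inductive side u v : vertex T -> Prop :=
| side_end : side u v v
| side_step x y : side u v x -> off_edge u v x y -> side u v y.

Lemma off_edge_sym u v x y : off_edge u v x y = off_edge u v y x.
Proof. by rewrite /off_edge adj_sym orbC andbC !(andbC (x == _)) andbC. Qed.

Lemma off_edgeC u v x y : off_edge u v x y = off_edge v u x y.
Proof. by rewrite /off_edge orbC. Qed.

Lemma side_adj u v x y : side u v x -> adj x y -> ~ side u v y -> x = v /\ y = u.
Proof.
move=> sx xy nsy; have [off|] := boolP (off_edge u v x y).
  by case: nsy; exact: side_step sx off.
rewrite /off_edge xy /= negbK => /orP[/andP[_ /eqP yv]|/andP[/eqP -> /eqP ->]] //.
by case: nsy; rewrite yv; exact: side_end.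
Qed.

Lemma side_total u v x : side u v x \/ side v u x.
Proof.
have [p + <-] := adj_conn u x.
elim/last_ind: p => [|p y IH]; first by right; exact: side_end.
rewrite rcons_path last_rcons => /andP[/IH + xy]; move: (last u p) xy => {IH}x xy sx.
have [off|] := boolP (off_edge u v x y).
  case: sx => sx; first by left; exact: side_step sx off.
  by right; apply: side_step sx _; rewrite off_edgeC.
rewrite /off_edge xy /= negbK => /orP[] /andP[_ /eqP ->]; [left|right]; exact: side_end.
Qed.

(** From [x] one walks back to [u] along the path that witnesses [side v u x], which avoids the
    edge. *)
Lemma side_merge u v x : side u v x -> side v u x -> side u v u.
Proof.
move=> + svu; elim: svu => // y z _ IH yz sz; apply: IH.
by apply: side_step sz _; rewrite off_edge_sym off_edgeC.
Qed.

Lemma side_path u v p x : side v u x -> path (@adj T) x p -> v \notin x :: p ->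
  side v u (last x p).
Proof.
elim: p x => //= y p IH x sx /andP[xy yp]; rewrite inE negb_or => /andP[vx vp].
apply: IH => //; apply: side_step sx _; rewrite /off_edge xy eq_sym (negPf vx) /=.
by move: vp; rewrite inE negb_or eq_sym => /andP[/negPf -> _]; rewrite andbF.
Qed.

Lemma side_branch v x : x != v -> exists2 u, adj v u & side v u x.
Proof.
have [p vp <-] := adj_conn v x; case/shortenP: vp => -[|u q] /=; first by rewrite eqxx.
move=> /andP[vu uq] /andP[vuq _] _ _; exists u => //.
by apply: side_path uq vuq; exact: side_end.
Qed.

Lemma side_cross u v x p : path (@adj T) x p -> side u v x -> ~ side u v (last x p) ->
  (v, u) \in zip (x :: p) p.
Proof.
elim: p x => [|y p IH] x //= /andP[xy yp] sx nsl.
have [sy|nsy] := pselect (side u v y); first by rewrite inE (IH y yp sy nsl) orbT.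
by have [-> ->] := side_adj sx xy nsy; rewrite inE eqxx.
Qed.

Hypothesis T_tree : is_tree T.

Lemma side_tree u v : adj u v -> ~ side u v u.
Proof.
move=> uv suu.
have path_of x : side u v x -> exists2 p, path (off_edge u v) v p & last v p = x.
  elim=> [|y z _ [p vp py] yz]; first by exists [::].
    by exists (rcons p z); rewrite ?last_rcons// rcons_path vp py.
have [p vp pu] := path_of u suu.
move: pu; case/shortenP: vp => q vq uq _ qu.
have /T_tree.2 : ucycle (@adj T) (v :: q).
  rewrite /ucycle /= rcons_path qu uv andbT.
  rewrite (sub_path _ vq) /=; first exact: uq.
  by move=> x y /andP[].
(* Acyclicity leaves cycles of size at most 2: size 1 would make [u] equal to [v], and size 2 would
   use the removed edge. *)
case: q vq qu {uq} => [_ /= vu|y [|//]].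
  by rewrite vu adj_irr in uv.
by rewrite /= andbT /off_edge => /andP[_ h] yu; rewrite yu !eqxx orbT in h.
Qed.

Lemma side_excl u v x : adj u v -> side u v x -> ~ side v u x.
Proof. by move=> uv suv svu; exact: side_tree uv (side_merge suv svu). Qed.

Lemma sideN u v x : adj u v -> ~ side u v x <-> side v u x.
Proof.
move=> uv; split=> [nuv|vu]; first by have [] := side_total u v x.
by apply: side_excl vu; rewrite adj_sym.
Qed.

(** The half-tree behind [a] does not contain [b], so paths inside it avoid the edge [{b, c}]; they
    are joined to [b] by the edge [{a, b}]. *)
Lemma side_nested a b c x : adj a b -> adj b c -> a != c -> side b a x -> side c b x.
Proof.
move=> ab bc ac sx; have ba : adj b a by rewrite adj_sym.
have bNa y : side b a y -> y != b.
  by move=> sy; apply/eqP => yb; rewrite yb in sy; exact: side_tree ba sy.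
elim: sx => [|y z sy IH yz].
  apply: (@side_step _ _ b); first exact: side_end.
  rewrite /off_edge ba (negPf ac) andbF orbF /= negb_and.
  by apply/orP; left; apply: contraTneq bc => ->; rewrite adj_irr.
apply: side_step IH _; have /negPf yb := bNa _ sy.
have /negPf zb := bNa _ (side_step sy yz).
by move: yz; rewrite /off_edge => /andP[-> _]; rewrite yb zb andbF.
Qed.

Lemma side_start (x : nat -> vertex T) : (forall k, adj (x k) (x k.+1)) ->
  (forall k, x k.+2 != x k) -> forall j k, (j <= k)%N -> side (x k.+1) (x k) (x j).
Proof.
move=> xA xN j k jk; rewrite -(subnK jk); elim: (k - j)%N => [|n IH].
  exact: side_end.
by apply: side_nested IH; rewrite // eq_sym; exact: xN.
Qed.

Lemma side_injective (x : nat -> vertex T) : (forall k, adj (x k) (x k.+1)) ->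
  (forall k, x k.+2 != x k) -> injective x.
Proof.
move=> xA xN.
have lt j k : (j < k)%N -> x j <> x k.
  case: k => // k; rewrite ltnS => jk e; have := side_start xA xN jk; rewrite e.
  by apply: side_tree; rewrite adj_sym.
by move=> j k e; have [/lt|/lt|//] := ltngtP j k; rewrite e.
Qed.

End Sides.

(** * Tree edges crossed by bounded jumps in the group *)

Section Crossing.
Variables (G : groupType) (S : generators G) (T : cgraph) (a : graph_action G T).
Implicit Types u v x : vertex T.
Local Open Scope group_scope.

Lemma actVK g v : act a g (act a g^-1 v) = v.
Proof. by rewrite -actM mulgV act1. Qed.

Lemma act_inj g : injective (act a g).
Proof. by move=> x y e; rewrite -(actK a g x) e actK. Qed.

Lemma side_act g u v x : side (act a g u) (act a g v) (act a g x) <-> side u v x.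
Proof.
have fwd h u' v' x' : side u' v' x' -> side (act a h u') (act a h v') (act a h x').
  elim=> [|y z _ IH yz]; first exact: side_end.
  apply: side_step IH _; move: yz; rewrite /off_edge act_adj.
  by rewrite !(inj_eq (@act_inj h)).
by split=> [/(fwd g^-1)|/fwd //]; rewrite !actK.
Qed.

(* With [J] as in [crossing_edges], a path from [act a g o] to [act a h o] that
   traverses (u, v) is witnessed by [crosses J u v g]. *)
Definition crosses (J : seq (vertex T * vertex T)) u v g : Prop :=
  (act a g^-1 u, act a g^-1 v) \in J.

(** After translation by [g^-1] the jump is one of finitely many elements, and any path from [o] to
    its image crosses the edge. [J] collects the steps of one such path for each element, in both
    directions. *)
Lemma crossing_edges o B : exists J : seq (vertex T * vertex T),
  (forall u v, (u, v) \in J -> (v, u) \in J) /\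
  forall g h u v, (wd S g h <= B)%N -> side u v (act a g o) -> ~ side u v (act a h o) ->
    crosses J u v g.
Proof.
have /choice[p pP] g : exists p, path (@adj T) o p /\ last o p = act a g o.
  by have [p ? ?] := adj_conn o (act a g o); exists p.
have [s sP] := word_ball S B.
pose J := flatten [seq zip (o :: p g) (p g) | g <- s].
exists (J ++ [seq (e.2, e.1) | e <- J]); split.
  move=> u v; rewrite !mem_cat => /orP[uJ|/mapP[[u' v'] uJ [-> ->]]].
    by apply/orP; right; apply/mapP; exists (u, v).
  by rewrite uJ.
move=> g h u v gh su nsu; rewrite /crosses mem_cat; apply/orP; right.
apply/mapP; exists (act a g^-1 v, act a g^-1 u) => //=.
apply/flattenP; have [pp pl] := pP (g^-1 * h).
exists (zip (o :: p (g^-1 * h)) (p (g^-1 * h))).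
  by apply/mapP; exists (g^-1 * h) => //; exact: sP.
apply: side_cross pp _ _.
  by apply/(side_act g); rewrite !actVK.
by rewrite pl actM => /(side_act g); rewrite !actVK.
Qed.

(** [g^-1 * h] maps one pair of [J] to another. One element [X j] is fixed for each pair of pairs in
    the same orbit, and [g^-1 * h] differs from it by an element of the edge stabiliser. *)
Lemma crosses_coset J : exists K, forall g h u v, crosses J u v g -> crosses J u v h ->
  exists2 e, e \in edge_group a (act a g^-1 u) (act a g^-1 v) & (wd S h (g * e) <= K)%N.
Proof.
pose V2 := (vertex T * vertex T)%type.
have /choice[X XP] (j : V2 * V2) : exists x : G,
    (exists y, act a y j.1.1 = j.2.1 /\ act a y j.1.2 = j.2.2) ->
    act a x j.1.1 = j.2.1 /\ act a x j.1.2 = j.2.2.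
  by have [[y yP]|n] := pselect (exists y, act a y j.1.1 = j.2.1 /\ act a y j.1.2 = j.2.2);
    [exists y|exists 1].
exists (\max_(j <- [seq (j, j') | j <- J, j' <- J]) word_length S (X j)) => g h u v Jg Jh.
pose j : V2 * V2 := ((act a h^-1 u, act a h^-1 v), (act a g^-1 u, act a g^-1 v)).
have [|x1 x2] := XP j; first by exists (g^-1 * h); rewrite /= !actM !actVK.
exists (g^-1 * h * (X j)^-1).
  rewrite unfold_in /edge_group !actM; apply/orP; left.
  rewrite /= in x1 x2.
  by rewrite -[in act a (X j)^-1 _]x1 -[in act a (X j)^-1 (act a g^-1 v)]x2 !actK !actVK !eqxx.
rewrite -!mulgA mulVKg wd_mul word_lengthV.
by apply: leq_bigmax_seq => //; apply: allpairs_f.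
Qed.

End Crossing.

(** * Rays of subgroups, visits to cosets, discretised rays *)

Section SubgroupRays.
Variables (R : realType) (G : groupType) (S : generators G).
Local Open Scope ring_scope.
Local Notation halfline := (set_type [set t : R | 0 <= t]).
Local Notation gp := (group_point R S).

Definition halfline_nat (n : nat) : halfline :=
  exist (fun t => t \in [set t : R | 0 <= t]) n%:R (mem_set (ler0n R n)).

Lemma discrete_qie_of_real (H : groupType) (SH : generators H) (f : H -> G) (C : R) :
  1 <= C -> (forall x y, C^-1 * (wd SH x y)%:R - C <= (wd S (f x) (f y))%:R
    <= C * (wd SH x y)%:R + C) -> exists n, discrete_qie S SH n f.
Proof.
move=> C1 h; pose c := (Num.truncn C).+1.
have Cc : C <= c%:R by apply/ltW/truncnS_gt.
exists (c * c)%N => x y; have := h x y; rewrite qi_lower// -!(ler_nat R).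
rewrite [(_ * _ * wd SH x y + _)%:R]natrD [(_ * _ * wd S _ _ + _)%:R]natrD.
rewrite [(_ * wd SH x y)%:R]natrM [(_ * wd S _ _)%:R]natrM [(c * c)%:R]natrM.
move: c%:R (wd SH x y)%:R (wd S (f x) (f y))%:R (ler0n R (wd SH x y)) (ler0n R (wd S (f x) (f y)))
  Cc => k l l' l0 l0' Cc /andP[h1 h2].
have kk : C <= k * k by rewrite -[leLHS]mulr1; apply: ler_pM; lra.
split.
  apply: le_trans h1 _; rewrite mulrDr; apply: lerD; first exact: ler_wpM2r.
  by apply: ler_pM; lra.
by apply: le_trans h2 _; apply: lerD => //; apply: ler_wpM2r.
Qed.

Section Embedding.
Variables (H : groupClosed G) (i : cayley_embedding R S H).
Local Notation SH := (sub_gens i).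

Lemma embedding_discrete_qie : exists C, discrete_qie S SH C (fun x => \val x).
Proof.
have [C C1 iC] := emb_qi i; apply: (discrete_qie_of_real C1) => x y.
have := iC (group_point R SH x) (group_point R SH y) I I.
by rewrite !emb_group_point !mdist_group_point.
Qed.

(** Points of [rel_boundary] must be Morse in [H] as well. The inclusion sends quasi-geodesics of
    [H] to quasi-geodesics of [G], and closeness in [G] gives closeness in [H]. *)
Lemma dmorse_pullback (SH' : generators (subgroup H)) C (w : nat -> subgroup H) :
  discrete_qie S SH' C (fun x => \val x) ->
  (forall C, exists M, dmorse_at S C M (range (fun n => \val (w n)))) ->
  forall C, exists M, dmorse_at SH' C M (range w).
Proof.
move=> vC wM C'; pose C2 := (C * C' + C + C')%N.
have [M MP] := wM (C2 * C2 + C2 * C2)%N; exists (C * M + C)%N => n q qC [x _ ex] [y _ ey] j jn.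
have [|||_ [k _ <-] dk] := MP n (fun j => \val (q j)) _ _ _ j jn.
- move=> k l kl; have [h1 h2] := qC k l kl; have [h3 h4] := vC (q k) (q l).
  move: (wd SH' _ _) (wd S _ _) h1 h2 h3 h4 => d d' h1 h2 h3 h4.
  have e1 : (C' * d <= C' * (C * d' + C))%N by rewrite leq_mul2l h3 orbT.
  have e2 : (C * d <= C * (C' * (l - k) + C'))%N by rewrite leq_mul2l h2 orbT.
  have e3 : (C' * C <= C2 * C2)%N by apply: leq_mul; rewrite /C2; lia.
  have sq m : (m <= m * m)%N by case: m => // m; rewrite leq_pmulr.
  have e4 : (C <= C2 * C2)%N by apply: leq_trans (sq _); rewrite /C2; lia.
  have e5 : (C' <= C2 * C2)%N by apply: leq_trans (sq _); rewrite /C2; lia.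
  have e6 : (C' * C * d' <= C2 * C2 * d')%N by rewrite leq_mul2r e3 orbT.
  have e7 : (C' * C * (l - k) <= C2 * C2 * (l - k))%N by rewrite leq_mul2r e3 orbT.
  by split; lia.
- by exists x; rewrite // ex.
- by exists y; rewrite // ey.
exists (w k); [by exists k|have [h _] := vC (q j) (w k)].
by apply: leq_trans h _; rewrite leq_add2r leq_mul2l dk orbT.
Qed.

Lemma subgroup_ray (w : nat -> subgroup H) : w 0%N = 1%g ->
  (forall m n, (m <= n)%N -> wd SH (w m) (w n) = (n - m)%N) ->
  (forall C, exists M, dmorse_at S C M (range (fun n => \val (w n)))) ->
  exists c : morse_ray (group_point R SH 1%g),
    morse (i @` range (\val c)) /\
    exists K : nat, coarsely_equal (S := S) K (i @` range (\val c)) (range (fun n => \val (w n))).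
Proof.
move=> w0 wP wM; have [c [cg cw]] := ray_of_path R w0 wP.
have near : coarsely_equal (S := SH) 1 (range c) (range w).
  split=> [_ [t _ <-]|_ [n _ <-]].
    by exists (w (Num.truncn (\val t))); [exists (Num.truncn (\val t))|exact: cw].
  exists (c (halfline_nat n)); first by exists (halfline_nat n).
  by have := cw (halfline_nat n); rewrite /= natrK.
have [C qC] := embedding_discrete_qie.
have /choice[N NP] := dmorse_pullback qC wM.
have cM : morse (range c) := morse_of_dmorse NP near.
have cP : is_morse_ray (group_point R SH 1%g) c by apply/asboolP.
have [D D1 iD] := emb_qi i.
have near' : coarsely_equal (S := S) (Num.truncn (D + D)).+1
    (i @` range c) (range (fun n => \val (w n))).
  have E x n : mdist x (group_point R SH (w n)) <= 1 ->
      mdist (i x) (gp (\val (w n))) <= (Num.truncn (D + D)).+1%:R.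
    move=> xn; rewrite -(emb_group_point i); have /andP[_ h] := iD x (group_point R SH (w n)) I I.
    apply: le_trans h (le_trans _ (ltW (truncnS_gt _))); rewrite lerD2r.
    by rewrite -[leRHS]mulr1 ler_wpM2l//; lra.
  split=> [_ [_ [t _ <-] <-]|_ [n _ <-]].
    by exists (\val (w (Num.truncn (\val t)))); [exists (Num.truncn (\val t))|exact: E].
  have [|_ [t _ <-] tn] := near.2 (w n) _; first by exists n.
  by exists (i (c t)); [exists (c t) => //; exists t|exact: E].
exists (exist _ c cP); split; last by exists (Num.truncn (D + D)).+1.
have /choice[N' NP'] := wM.
exact: morse_of_dmorse NP' near'.
Qed.

(* Otherwise longer and longer segments of Morse paths fellow-travel H, and a limit
   of them is a ray of H that is Morse in G. *)
Lemma coset_bound A N K : rel_boundary i = set0 -> exists D, forall p s t g,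
  morse_path S A N p -> (s <= t)%N ->
  (exists h : subgroup H, wd S (p s) (g * \val h)%g <= K)%N ->
  (exists h : subgroup H, wd S (p t) (g * \val h)%g <= K)%N -> (t - s <= D)%N.
Proof.
move=> rel0; apply: contrapT => nD.
have {nD} /choice[F FP] n : exists F : (nat -> G) * (nat * nat) * (G * (subgroup H * subgroup H)),
    [/\ morse_path S A N F.1.1, (F.1.2.1 <= F.1.2.2)%N, (n <= F.1.2.2 - F.1.2.1)%N,
      (wd S (F.1.1 F.1.2.1) (F.2.1 * \val F.2.2.1)%g <= K)%N &
      (wd S (F.1.1 F.1.2.2) (F.2.1 * \val F.2.2.2)%g <= K)%N].
  apply: contrapT => nF; apply: nD; exists n => p s t g pM st [h hs] [h' ht].
  rewrite leqNgt; apply/negP => nst; apply: nF.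
  by exists (p, (s, t), (g, (h, h'))); split=> //; exact: ltnW.
have [C qC] := embedding_discrete_qie.
have [M MP] := limit_path A N K qC.
(* The point of the coset close to the start of the segment: translation by its inverse turns the
   coset into [H] and makes all segments start near 1. *)
pose x n := ((F n).2.1 * \val (F n).2.2.1)%g.
pose p n m := ((x n)^-1 * (F n).1.1 m)%g.
have [|||||w [w0 wg wlim]] := MP p (fun n => (F n).1.2.1) (fun n => (F n).1.2.2)
    (fun n => ((F n).2.2.1^-1 * (F n).2.2.2)%g).
- by move=> n; rewrite /p; apply: morse_pathM; have [] := FP n.
- by move=> n; have [] := FP n.
- by move=> n; have [] := FP n.
- move=> n; have [_ _ _ h _] := FP n.
  by rewrite val1 -(wdM S (x n)) mulg1 mulVKg wdC.
- move=> n; have [_ _ _ _ h] := FP n.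
  rewrite -(wdM S (x n)) mulVKg wdC; move: h; congr (wd _ _ _ <= _)%N.
  by rewrite /x -mulgA -valM mulVKg.
have pM n : morse_path S A N (p n) by rewrite /p; apply: morse_pathM; have [] := FP n.
have [c [cM _]] := subgroup_ray w0 wg (limit_dmorse pM wlim).
have : rel_boundary i (endpoint c) by exists c.
by rewrite rel0.
Qed.

End Embedding.

Definition discretize (c : halfline -> cayley_space R S) (n : nat) : G :=
  rounding (c (halfline_nat n)).

Lemma discretize0 c : geodesic_ray (gp 1%g) c -> discretize c 0 = 1%g.
Proof.
by case=> c0 _; rewrite /discretize c0 ?rounding_group_point.
Qed.

Lemma discretize_near c t : geodesic_ray (gp 1%g) c ->
  mdist (c t) (gp (discretize c (Num.truncn (\val t)))) <= 2.
Proof.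
move=> [_ cg]; apply: le_trans (metric_triangle _ (c (halfline_nat (Num.truncn (\val t)))) _) _.
have -> : 2 = 1 + 1 :> R by [].
apply: lerD; last exact: mdist_rounding.
have t0 : 0 <= \val t by case: t => t /= /set_mem.
have /andP[h1 h2] := truncn_itv t0; rewrite -natr1 in h2.
rewrite cg -[\val (halfline_nat _)]/((Num.truncn (\val t))%:R).
by rewrite ger0_norm; lra.
Qed.

Lemma discretize_coarse c : geodesic_ray (gp 1%g) c ->
  coarsely_equal (S := S) 2 (range c) (range (discretize c)).
Proof.
move=> cg; split=> [_ [t _ <-]|_ [n _ <-]].
  by exists (discretize c (Num.truncn (\val t))); [exists (Num.truncn (\val t))|exact: discretize_near].
exists (c (halfline_nat n)); first by exists (halfline_nat n).
by apply: le_trans (mdist_rounding _) _; rewrite ler1n.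
Qed.

Lemma discretize_wd c m n : geodesic_ray (gp 1%g) c -> (m <= n)%N ->
  (n - m <= wd S (discretize c m) (discretize c n) + 2)%N /\
  (wd S (discretize c m) (discretize c n) <= n - m + 2)%N.
Proof.
move=> [_ cg] mn; have := cg (halfline_nat m) (halfline_nat n).
rewrite -[\val (halfline_nat m)]/(m%:R) -[\val (halfline_nat n)]/(n%:R).
rewrite distrC ger0_norm ?subr_ge0 ?ler_nat// -natrB//.
rewrite -!(ler_nat R) !natrD -!(mdist_group_point R) /discretize.
set x := c _; set y := c (halfline_nat n).
have := mdist_rounding x; have := mdist_rounding y.
have := metric_triangle x (gp (rounding x)) y.
have := metric_triangle (gp (rounding x)) (gp (rounding y)) y.
have := metric_triangle (gp (rounding x)) x (gp (rounding y)).
have := metric_triangle x y (gp (rounding y)).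
rewrite (metric_sym (gp (rounding x)) x) (metric_sym (gp (rounding y)) y).
by move: (n - m)%:R => l *; split; lra.
Qed.

Lemma discretize_path c N : geodesic_ray (gp 1%g) c -> morse_with N (range c) ->
  morse_path S 2 (discrete_gauge N 2) (discretize c).
Proof.
move=> cg cM; split; last by apply: discretize_morse cM (discretize_coarse cg).
by move=> n m k /andP[mk _]; have := discretize_wd cg mk; lia.
Qed.

End SubgroupRays.

(** * Edge crossings of Morse rays *)

Section EdgeCrossings.
Variables (R : realType) (G : groupType) (S : generators G).
Variables (T : cgraph) (a : graph_action G T) (o : vertex T).
Hypothesis T_tree : is_tree T.
Hypothesis edge_empty : forall u v : vertex T, adj u v ->
  exists i : cayley_embedding R S (edge_group a u v), rel_boundary i = set0.
Local Notation d := (wd S).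

(** [D] is the same for all edges: a crossed edge is a translate of one in [J], and [coset_bound]
    allows every coset of the stabiliser of the latter. *)
Lemma crossing_bound J A N K : exists D, forall p u v s t, adj u v ->
  morse_path S A N p -> (s <= t)%N ->
  (exists2 g, (d (p s) g <= K)%N & crosses a J u v g) ->
  (exists2 g, (d (p t) g <= K)%N & crosses a J u v g) -> (t - s <= D)%N.
Proof.
have [K0 K0P] := crosses_coset S a J.
have /choice[D DP] (j : vertex T * vertex T) : exists D, adj j.1 j.2 ->
    forall p s t g, morse_path S A N p -> (s <= t)%N ->
    (exists h : subgroup (edge_group a j.1 j.2), d (p s) (g * \val h)%g <= K + K0)%N ->
    (exists h : subgroup (edge_group a j.1 j.2), d (p t) (g * \val h)%g <= K + K0)%N ->
    (t - s <= D)%N.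
  have [uv|] := boolP (adj j.1 j.2); last by exists 0%N.
  have [i i0] := edge_empty uv; have [D DP] := coset_bound A N (K + K0) i0.
  by exists D.
exists (\max_(j <- J) D j) => p u v s t uv pM st [g gs Jg] [h ht Jh].
pose j := (act a g^-1 u, act a g^-1 v)%g.
apply: (@leq_trans (D j)); last exact: leq_bigmax_seq.
apply: (DP j _ p s t g) => //; first by rewrite act_adj.
  by exists 1%g; rewrite val1 mulg1 (leq_trans gs)// leq_addr.
have [e eE he] := K0P _ _ _ _ Jg Jh.
exists (exist (fun x => x \in edge_group a j.1 j.2) e eE) => /=.
by apply: leq_trans (wdD S _ h _) _; apply: leq_add.
Qed.

(** If the tolerance is raised to the distance from 1 to one fixed crossing point [g1], time 0
    counts as a visit too. *)
Lemma crossing_time J A N K u v : adj u v -> exists D, forall p t g,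
  morse_path S A N p -> p 0%N = 1%g -> (d (p t) g <= K)%N -> crosses a J u v g ->
  (t <= D)%N.
Proof.
move=> uv; have [[g1 Jg1]|nJ] := pselect (exists g, crosses a J u v g); last first.
  by exists 0%N => p t g _ _ _ Jg; case: nJ; exists g.
have [D DP] := crossing_bound J A N (maxn K (d 1%g g1)).
exists D => p t g pM p0 pg Jg; rewrite -[t]subn0.
apply: (DP p u v 0%N t uv pM (leq0n _)); last by exists g; rewrite // leq_max pg.
by exists g1; rewrite // p0 leq_max leqnn orbT.
Qed.

Lemma sides_stable B N u v : adj u v -> exists D, forall p t h,
  morse_path S 2 N p -> p 0%N = 1%g -> (D <= t)%N -> (d (p t) h <= B)%N ->
  side u v (act a (p t) o) <-> side u v (act a h o).
Proof.
move=> uv; have [J [Jsym JP]] := crossing_edges S a o B.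
have [D DP] := crossing_time J 2 N B uv.
exists D.+1 => p t h pM p0 Dt pth.
have noC x : crosses a J u v x -> (d (p t) x <= B)%N -> False.
  by move=> Jx px; have := DP p t x pM p0 px Jx; lia.
split=> su; apply: contrapT => nsu.
  apply: (noC (p t)); last by rewrite wdxx.
  exact: JP su nsu.
apply: (noC h) => //; rewrite wdC in pth.
exact: JP su nsu.
Qed.

Definition ends_in u v (p : nat -> G) : Prop :=
  exists n0, forall n, (n0 <= n)%N -> side u v (act a (p n) o).

(** The final side can be read off at a time [D] common to all [N]-Morse paths, even from a nearby
    point [h]: this gives openness in the strata. The 4 below is the step length [2 * 1 + 2] of
    these paths. *)
Lemma ends_in_stable B N u v : adj u v -> exists D, forall p t h,
  morse_path S 2 N p -> p 0%N = 1%g -> (D <= t)%N -> (d (p t) h <= B)%N ->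
  side u v (act a h o) <-> ends_in u v p.
Proof.
move=> uv; have [D DP] := sides_stable B N uv; have [D' DP'] := sides_stable 4 N uv.
have step p t : morse_path S 2 N p -> (d (p t) (p t.+1) <= 4)%N.
  move=> pM; have [|_] := pM.1 t.+1 t t.+1; first by rewrite leqnSn leqnn.
  by rewrite subSnn.
exists (maxn D D') => p t h pM p0; rewrite geq_max => /andP[Dt Dt'] ph.
rewrite -(DP p t h)//.
have all_n n : side u v (act a (p (t + n)%N) o) <-> side u v (act a (p t) o).
  elim: n => [|n <-]; first by rewrite addn0.
  by rewrite addnS; symmetry; apply: DP' => //; [lia|exact: step].
split=> [su|[n0 su]]; last by apply/(all_n n0)/su; rewrite leq_addl.
by exists t => n tn; rewrite -(subnKC tn); apply/all_n.
Qed.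

Lemma ends_in_total N u v p : adj u v -> morse_path S 2 N p -> p 0%N = 1%g ->
  ends_in u v p \/ ends_in v u p.
Proof.
move=> uv pM p0; have vu : adj v u by rewrite adj_sym.
have [D DP] := ends_in_stable 0 N uv; have [D' DP'] := ends_in_stable 0 N vu.
have [] := side_total u v (act a (p (maxn D D')) o) => s; [left|right].
  by apply/(DP p (maxn D D') (p (maxn D D')) pM p0 _ _) => //; rewrite ?leq_maxl ?wdxx.
by apply/(DP' p (maxn D D') (p (maxn D D')) pM p0 _ _) => //; rewrite ?leq_maxr ?wdxx.
Qed.

Lemma ends_in_excl u v p : adj u v -> ends_in u v p -> ~ ends_in v u p.
Proof.
move=> uv [n nP] [m mP].
exact: (side_excl T_tree uv (nP _ (leq_maxl n m)) (mP _ (leq_maxr n m))).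
Qed.

Section Boundary.
Local Open Scope ring_scope.
Local Notation ray := (morse_ray (group_point R S 1%g)).

Lemma morse_ray_path (c : ray) : exists N, morse_path S 2 N (discretize (\val c)).
Proof.
have /asboolP[cg [N gN cM]] := valP c.
by exists (discrete_gauge N 2); exact: discretize_path.
Qed.

Lemma morse_ray_geodesic (c : ray) : geodesic_ray (group_point R S 1%g) (\val c).
Proof. by have /asboolP[] := valP c. Qed.

Lemma ends_in_asymptotic u v (c c' : ray) : adj u v -> asymptotic c c' ->
  ends_in u v (discretize (\val c')) -> ends_in u v (discretize (\val c)).
Proof.
move=> uv /asboolP[D [cc' _]] [n0 nP].
have [N cM] := morse_ray_path c; have cg := morse_ray_geodesic c.
have cg' := morse_ray_geodesic c'.
(* The 4 adds up rounding on [c], truncation of [D], and the 2 of [discretize_near]. In [n], the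
   other 4 is twice the error of [discretize_wd], so that [n0 <= k]. *)
pose B := (Num.truncn D + 4)%N; have [E EP] := ends_in_stable B N uv.
pose n := maxn E (n0 + B + 4)%N.
have [_ [t _ <-] ct] := cc' _ (imageT (\val c) (halfline_nat R n)).
pose k := Num.truncn (\val t).
have dB : (d (discretize (\val c) n) (discretize (\val c') k) <= B)%N.
  rewrite -(ler_nat R) -mdist_group_point /B natrD.
  have h1 := mdist_rounding (\val c (halfline_nat R n)).
  rewrite metric_sym -/(discretize (\val c) n) in h1.
  have h2 := discretize_near t cg'; rewrite -/k in h2.
  have h3 := truncnS_gt D; rewrite -natr1 in h3.
  apply: le_trans (metric_triangle _ (\val c (halfline_nat R n)) _) _.
  have h4 := metric_triangle (\val c (halfline_nat R n)) (\val c' t)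
    (group_point R S (discretize (\val c') k)).
  lra.
apply/(EP _ n (discretize (\val c') k) cM (discretize0 cg) _ dB); first exact: leq_maxl.
apply: nP.
have [h1 _] := discretize_wd cg (leq0n n); have [_ h2] := discretize_wd cg' (leq0n k).
rewrite !discretize0// in h1 h2.
have := wdD S 1%g (discretize (\val c') k) (discretize (\val c) n).
by rewrite (wdC S (discretize (\val c') k)); lia.
Qed.

Definition toward u v : set (group_morse_boundary R S) :=
  [set xi | exists2 c, endpoint c = xi & ends_in u v (discretize (\val c))].

Lemma toward_endpoint u v (c : ray) : adj u v ->
  toward u v (endpoint c) <-> ends_in u v (discretize (\val c)).
Proof.
move=> uv; split=> [[c' /endpointP cc' ec']|ec]; last by exists c.
by apply: ends_in_asymptotic ec' => //; rewrite asymptotic_sym.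
Qed.

Lemma toward_open u v : adj u v -> open (toward u v).
Proof.
move=> uv; suff h : boundary_open (toward u v) by exact: h.
(* Rays less than 1 apart at time [D] have discretisations at most 3 apart there. Evaluation at the
   single time [D] gives compact-open neighbourhoods [V c]. *)
move=> N gN; have [D DP] := ends_in_stable 3 (discrete_gauge N 2) uv.
pose t0 := halfline_nat R D; set P := _ @^-1` _.
pose V (c : set_type (morse_rays (group_point R S 1%g) N)) :=
  [set f : {compact-open, set_type [set t : R | 0 <= t] -> cayley_space R S} |
    f @` [set t0] `<=` (ball (\val c t0) 1)°].
suff -> : P = \bigcup_(c in P) (set_val @^-1` V c).
  apply: bigcup_open => c _; exists (V c) => //.
  by apply: compact_open_open; [exact: compact_set1|exact: open_interior].
apply/seteqP; split=> [c Pc|c [c' Pc' Vc]].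
  exists c => // _ [_ -> <-]; exact: (@nbhsx_ballx R _ _ 1 ltr01).
have [[cg cM] [cg' cM']] : (geodesic_ray (group_point R S 1%g) (\val c) /\
    morse_with N (range (\val c))) /\ (geodesic_ray (group_point R S 1%g) (\val c') /\
    morse_with N (range (\val c'))).
  by case: c {Vc} => c /= /set_mem; case: c' {Pc'} => c' /= /set_mem.
apply/toward_endpoint => //=; move/toward_endpoint: Pc' => /= /(_ uv) h.
apply/(DP _ D (discretize (\val c') D) (discretize_path cg cM) (discretize0 cg)) => //.
  rewrite wdC -(ler_nat R) -mdist_group_point.
  have : ball (\val c' t0) 1 (\val c t0) by apply: interior_subset; apply: Vc; exists t0.
  rewrite ballEmdist /= => cc'.
  apply: le_trans (metric_triangle _ (\val c' t0) _) _.
  have h1 := mdist_rounding (\val c' t0); rewrite metric_sym -/(discretize (\val c') D) in h1.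
  have h2 := mdist_rounding (\val c t0); rewrite -/(discretize (\val c) D) in h2.
  have h3 := metric_triangle (\val c' t0) (\val c t0) (group_point R S (discretize (\val c) D)).
  have -> : 3%:R = 1 + 1 + 1 :> R by ring.
  rewrite -addrA; apply: lerD h1 _; apply: le_trans h3 _; apply: lerD => //.
  exact: ltW cc'.
apply/(DP _ D _ (discretize_path cg' cM') (discretize0 cg')) => //.
by rewrite wdxx.
Qed.

Lemma towardC u v : adj u v -> ~` toward u v = toward v u.
Proof.
move=> uv; have vu : adj v u by rewrite adj_sym.
apply/seteqP; split=> xi; rewrite -[xi](@reprK _ _); set c := repr xi.
  move=> nt; have [N cM] := morse_ray_path c.
  have [h|h] := ends_in_total uv cM (discretize0 (morse_ray_geodesic c)).
    by case: nt; apply/toward_endpoint.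
  by apply/toward_endpoint.
by move=> /(toward_endpoint _ vu) h /(toward_endpoint _ uv); exact: ends_in_excl h.
Qed.

Lemma component_toward xi u v : adj u v ->
  connected_component setT xi `<=` toward u v \/ connected_component setT xi `<=` toward v u.
Proof.
move=> uv; rewrite -(towardC uv); apply: connected_subset.
- apply/clopen_separatedP; split; first exact: toward_open.
  by rewrite -openC towardC//; apply: toward_open; rewrite adj_sym.
- by move=> x _; rewrite setUv.
- exact: component_connected.
Qed.

End Boundary.
End EdgeCrossings.

Lemma last_time (P : nat -> Prop) i n : (i <= n)%N -> P i -> ~ P n ->
  exists t, [/\ (i <= t < n)%N, P t & ~ P t.+1].
Proof.
move=> le_in; rewrite -(subnKC le_in); elim: (n - i)%N => [|m IH] Pi nP.
  by rewrite addn0 in nP.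
have [Pm|nPm] := pselect (P (i + m)%N).
  by exists (i + m)%N; split; rewrite -?addnS//; lia.
by have [t [tm Pt nPt]] := IH Pi nPm; exists t; split=> //; lia.
Qed.

Lemma injective_notin (X : eqType) (f : nat -> X) (s : seq X) :
  injective f -> exists k, f k \notin s.
Proof.
move=> finj; apply: contrapT => nk.
have : (size (map f (iota 0 (size s).+1)) <= size s)%N.
  apply: uniq_leq_size; first by rewrite map_inj_uniq ?iota_uniq.
  by move=> _ /mapP[k _ ->]; apply/negPn/negP => fk; apply: nk; exists k.
by rewrite size_map size_iota ltnn.
Qed.

(** * Criteria for asymptotic rays and for images of subgroup boundaries *)

Section Rays.
Variables (R : realType) (G : groupType) (S : generators G).
Local Open Scope ring_scope.
Local Notation d := (wd S).
Local Notation gp := (group_point R S).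
Local Notation ray := (morse_ray (gp 1%g)).

Lemma quasi_path_step A p n : (forall n, quasi_path S A n p) -> (d (p n) (p n.+1) <= 2 * A)%N.
Proof.
move=> pA; have [|_] := pA n.+1 n n.+1; first by rewrite leqnSn leqnn.
by rewrite subSnn; lia.
Qed.

(** The part of [p'] from 1 to a point near [m] has both ends close to [p], hence stays close to
    [p]; as [m] goes far, these parts exhaust [p']. *)
Lemma far_common_points A N M p p' : morse_path S A N p ->
  (forall n, quasi_path S A n p') -> p 0%N = 1%g -> p' 0%N = 1%g ->
  (forall L, exists m, (L < word_length S m)%N /\
     exists r r', (d m (p r) <= M)%N /\ (d m (p' r') <= M)%N) ->
  exists M', forall i, exists s, (d (p' i) (p s) <= M')%N.
Proof.
move=> [pA pM] p'A p0 p'0 far; exists (N (ext_cst (M + M) A)) => i.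
have [m [ml [r [r' [mr mr']]]]] := far (A * i + A + M)%N.
have ir : (i <= r')%N.
  rewrite leqNgt; apply/negP => ri.
  have [|_] := p'A r' 0%N r'; first by rewrite leqnn.
  have := wdD S 1%g (p' r') m; rewrite wd1 p'0 (wdC S (p' r')) subn0 => h1 h2.
  by have : (A * r' <= A * i)%N; [rewrite leq_mul2l ltnW ?orbT|lia].
have [||_ [s _ <-] h] := @dmorse_near _ S N _ A (M + M) r' p' (p 0%N) (p r) pM (p'A r')
  (imageT p 0%N) (imageT p r) _ _ i ir.
- by rewrite p0 p'0 wdxx.
- by apply: leq_trans (wdD S _ m _) _; rewrite wdC leq_add.
- by exists s.
Qed.

Lemma finite_hausdorff_discretize (c c' : ray) M :
  (forall i, exists s, (d (discretize (\val c) i) (discretize (\val c') s) <= M)%N) ->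
  (forall i, exists s, (d (discretize (\val c') i) (discretize (\val c) s) <= M)%N) ->
  asymptotic c c'.
Proof.
have half (b b' : ray) t :
    (forall i, exists s, (d (discretize (\val b) i) (discretize (\val b') s) <= M)%N) ->
    exists s, mdist (\val b t) (\val b' s) <= 3 + M%:R.
  move=> h; have [s hs] := h (Num.truncn (\val t)); exists (halfline_nat R s).
  have h1 := discretize_near t (morse_ray_geodesic b).
  have h2 := mdist_rounding (\val b' (halfline_nat R s)).
  rewrite metric_sym -/(discretize (\val b') s) in h2.
  rewrite -(ler_nat R) -(mdist_group_point R) in hs.
  apply: le_trans (metric_triangle _ (gp (discretize (\val b') s)) _) _.
  have h3 := metric_triangle (\val b t) (gp (discretize (\val b) (Num.truncn (\val t))))
    (gp (discretize (\val b') s)).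
  lra.
move=> cc' c'c; apply/asboolP; exists (3 + M%:R); split=> [_ [t _ <-]|_ [t _ <-]].
  by have [s hs] := half _ _ t cc'; exists (\val c' s).
by have [s hs] := half _ _ t c'c; exists (\val c s); rewrite // metric_sym.
Qed.

Section Embedding.
Variables (H : groupClosed G) (i : cayley_embedding R S H).

Lemma boundary_image_of_near (c : ray) K :
  (forall n, exists h : subgroup H, (d (discretize (\val c) n) (\val h) <= K)%N) ->
  rel_boundary_image i (endpoint c).
Proof.
move=> near; pose p := discretize (\val c).
have cg := morse_ray_geodesic c.
have [N pM] := morse_ray_path c; have p0 := discretize0 cg; rewrite -/p in pM p0.
have /choice[h hP] := near.
have [C qC] := embedding_discrete_qie i.
have [M MP] := limit_path 2 N K qC.
(* The segments are now the initial segments of the single path [p]; geodesics of [H] to the points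
   [h n] converge to a ray along [p]. *)
have [|||||w [w0 wg wlim]] := MP (fun=> p) (fun=> 0%N) id h => //.
- by move=> n; rewrite subn0.
- by move=> n; rewrite val1 p0 wdxx.
- by move=> n; rewrite wdC; exact: hP.
have [b [bM [K' bw]]] := subgroup_ray w0 wg (limit_dmorse (fun=> pM) wlim).
exists (endpoint b); first by exists b.
exists b, c; split=> //; exists (K' + M + 2)%:R; split.
  move=> _ [t _ <-]; have ct := discretize_near t cg; rewrite -/p in ct.
  set r := Num.truncn _ in ct.
  have [n nk [_ hn]] := wlim (maxn r (d 1%g (p r))).
  have [||k hk] := hn r; [by move: nk; rewrite /id; lia|by rewrite val1 leq_maxr|].
  have [y Ay yk] := bw.2 _ (imageT (fun n => \val (w n)) k); exists y => //.
  rewrite -(ler_nat R) -(mdist_group_point R) in hk; rewrite !natrD.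
  have h1 := metric_triangle (\val c t) (gp (p r)) y.
  have h2 := metric_triangle (gp (p r)) (gp (\val (w k))) y.
  rewrite metric_sym in yk; rewrite metric_sym in hk; lra.
move=> x /(bw.1)[_ [k _ <-] xk].
have [n nk [hn _]] := wlim k; have [r _ hk] := hn k (leqnn k).
exists (\val c (halfline_nat R r)); first by exists (halfline_nat R r).
rewrite -(ler_nat R) -(mdist_group_point R) in hk; rewrite !natrD.
have h1 := mdist_rounding (\val c (halfline_nat R r)); rewrite -/(discretize _ _) -/(p r) in h1.
have h2 := metric_triangle (\val c (halfline_nat R r)) (gp (p r)) x.
have h3 := metric_triangle (gp (p r)) (gp (\val (w k))) x.
rewrite metric_sym in xk; rewrite metric_sym in hk; lra.
Qed.

Lemma near_of_boundary_image (c : ray) : rel_boundary_image i (endpoint c) ->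
  exists K, forall n, exists h : subgroup H, (d (discretize (\val c) n) (\val h) <= K)%N.
Proof.
move=> [_ _ [b [c' [_ /endpointP /asboolP[D [_ cc']] [E [bE _]]]]]].
have [F F1 iF] := emb_qi i.
exists (Num.truncn (1 + D + E + (F + F))).+1 => n.
have [_ [t _ <-] h1] := cc' _ (imageT (\val c) (halfline_nat R n)).
have [_ [z [s _ <-] <-] h2] := bE _ (imageT (\val c') t).
pose h := rounding (\val b s); exists h.
have h3 := mdist_rounding (\val b s); rewrite -/h in h3.
have /andP[_ h4] := iF (\val b s) (group_point R (sub_gens i) h) I I.
rewrite emb_group_point in h4.
have h5 : F * mdist (\val b s) (group_point R (sub_gens i) h) <= F * 1.
  by apply: ler_wpM2l => //; lra.
have h6 := mdist_rounding (\val c (halfline_nat R n)); rewrite -/(discretize _ _) in h6.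
rewrite -(ler_nat R) -(mdist_group_point R).
apply: le_trans (_ : _ <= 1 + D + E + (F + F)) (ltW (truncnS_gt _)).
rewrite metric_sym in h6.
have h7 := metric_triangle (gp (discretize (\val c) n)) (\val c (halfline_nat R n)) (gp (\val h)).
have h8 := metric_triangle (\val c (halfline_nat R n)) (\val c' t) (gp (\val h)).
have h9 := metric_triangle (\val c' t) (i (\val b s)) (gp (\val h)).
rewrite (metric_sym (\val c' t) (\val c _)) in h1.
lra.
Qed.

End Embedding.
End Rays.

(** * Ends and sinks of the orientation of the tree *)

Section Components.
Variables (R : realType) (G : groupType) (S : generators G).
Variables (T : cgraph) (a : graph_action G T) (o : vertex T).
Hypothesis T_tree : is_tree T.
Hypothesis edge_empty : forall u v : vertex T, adj u v ->
  exists i : cayley_embedding R S (edge_group a u v), rel_boundary i = set0.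
Local Notation d := (wd S).

Lemma edge_qie (J : seq (vertex T * vertex T)) : exists C, forall j, j \in J -> adj j.1 j.2 ->
  exists SH : generators (subgroup (edge_group a j.1 j.2)),
    discrete_qie S SH C (fun x => \val x).
Proof.
have /choice[F FP] (j : vertex T * vertex T) : exists C, adj j.1 j.2 ->
    exists SH : generators (subgroup (edge_group a j.1 j.2)), discrete_qie S SH C (fun x => \val x).
  have [uv|] := boolP (adj j.1 j.2); last by exists 0%N.
  have [i _] := edge_empty uv; have [C qC] := embedding_discrete_qie i.
  by exists C => _; exists (sub_gens i).
exists (\max_(j <- J) F j)%N => j jJ uv; have [SH qC] := FP j uv; exists SH => x y.
have FC : (F j <= \max_(j <- J) F j)%N by exact: leq_bigmax_seq.
have [h1 h2] := qC x y.
split; [apply: leq_trans h1 _|apply: leq_trans h2 _]; by rewrite leq_add// leq_mul2r FC orbT.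
Qed.

Lemma crosses_edge_group J u v g e : (forall u v, (u, v) \in J -> (v, u) \in J) ->
  crosses a J u v g -> e \in edge_group a (act a g^-1 u)%g (act a g^-1 v)%g ->
  crosses a J u v (g * e)%g.
Proof.
move=> Jsym Jg /gpredVr; rewrite unfold_in /edge_group /crosses invgM !actM.
by case/orP=> /andP[/eqP -> /eqP ->]; [exact: Jg|exact: Jsym].
Qed.

(** Both paths visit the coset of [p t]. The quasi-geodesic of [coset_projection] from 1 through [m]
    can be made to end near either path, and the Morse property brings that path close to [m]. *)
Lemma common_crossing A J N N' p p' : (forall u v, (u, v) \in J -> (v, u) \in J) ->
  morse_path S A N p -> morse_path S A N' p' -> p 0%N = 1%g -> p' 0%N = 1%g ->
  exists M, forall u v t t', adj u v -> crosses a J u v (p t) -> crosses a J u v (p' t') ->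
    exists m, crosses a J u v m /\
      exists r r', (d m (p r) <= M)%N /\ (d m (p' r') <= M)%N.
Proof.
move=> Jsym [pA pM] [p'A p'M] p0 p'0.
have [K0 K0P] := crosses_coset S a J; have [C CP] := edge_qie J.
exists (maxn (N (ext_cst K0 (2 * C + 1))) (N' (ext_cst K0 (2 * C + 1)))) => u v t t' uv Jp Jp'.
have [|SH qC] := CP _ Jp; first by rewrite act_adj.
have [m [[e em] _ mP]] := coset_projection qC (val1 _) (@valM _ _ _) (p t).
exists m; split; first by rewrite em; apply: crosses_edge_group => //; exact: valP.
have near B q s NB : dmorse S NB (range q) -> q 0%N = 1%g ->
    (exists f : subgroup (edge_group a (act a (p t)^-1 u)%g (act a (p t)^-1 v)%g),
      (d (p t * \val f)%g (q s) <= B)%N) ->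
    exists r, (d m (q r) <= NB (ext_cst B (2 * C + 1)))%N.
  move=> qM q0 [f fs]; have [n [w [wC w0 wn [i ni wi]]]] := mP f.
  have [||_ [r _ <-] h] := @dmorse_near _ S NB _ _ B n w (q 0%N) (q s) qM wC
    (imageT q 0%N) (imageT q s) _ _ i ni.
  - by rewrite w0 q0 wdxx.
  - by rewrite wn.
  - by exists r; rewrite -wi.
have [r hr] : exists r, (d m (p r) <= N (ext_cst K0 (2 * C + 1)))%N.
  apply: (near _ p t) => //; exists 1%g; by rewrite val1 mulg1 wdxx.
have [r' hr'] : exists r', (d m (p' r') <= N' (ext_cst K0 (2 * C + 1)))%N.
  apply: (near _ p' t') => //; have [f fE ft] := K0P _ _ _ _ Jp Jp'.
  by exists (exist (fun x => x \in edge_group a _ _) f fE); rewrite wdC.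
by exists r, r'; rewrite !leq_max hr hr' orbT.
Qed.

Section TreeEnd.
Variable x : nat -> vertex T.
Hypotheses (x0 : x 0%N = o) (xA : forall k, adj (x k) (x k.+1)) (xN : forall k, x k.+2 != x k).

Lemma crossing_towards_end J N p k : morse_path S 2 N p -> p 0%N = 1%g ->
  (forall g h u v, (d g h <= 4)%N -> side u v (act a g o) -> ~ side u v (act a h o) ->
    crosses a J u v g) ->
  ends_in a o (x k) (x k.+1) p -> exists t, crosses a J (x k.+1) (x k) (p t).
Proof.
move=> pM p0 JP [n nP].
have xA' : adj (x k.+1) (x k) by rewrite adj_sym.
have [||t [_ t1 t2]] := @last_time (fun t => side (x k.+1) (x k) (act a (p t) o)) 0%N n (leq0n n).
- by rewrite p0 act1 -x0; exact: side_start.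
- by apply: side_excl (nP _ (leqnn n)).
by exists t; apply: JP t1 t2; exact: quasi_path_step pM.1.
Qed.

Lemma end_asymptotic (c c' : morse_ray (group_point R S 1%g)) :
  (forall k, ends_in a o (x k) (x k.+1) (discretize (\val c))) ->
  (forall k, ends_in a o (x k) (x k.+1) (discretize (\val c'))) -> asymptotic c c'.
Proof.
move=> ce c'e; have [N pM] := morse_ray_path c; have [N' p'M] := morse_ray_path c'.
have p0 := discretize0 (morse_ray_geodesic c); have p'0 := discretize0 (morse_ray_geodesic c').
have [J [Jsym JP]] := crossing_edges S a o 4.
have [M MP] := common_crossing Jsym pM p'M p0 p'0.
have far L : exists m, (L < word_length S m)%N /\ exists r r',
    (d m (discretize (\val c) r) <= M)%N /\ (d m (discretize (\val c') r') <= M)%N.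
  (* Elements of length at most [L] cross only the finitely many edges of [E], whereas the edges
     along [x] are pairwise distinct. *)
  have [s sP] := word_ball S L.
  pose E := [seq (act a g j.1, act a g j.2) | g <- s, j <- J].
  have finj : injective (fun k => (x k.+1, x k)).
    by move=> j k [_]; exact: side_injective.
  have [k kE] := injective_notin E finj.
  have [t Jt] := crossing_towards_end pM p0 JP (ce k).
  have [t' Jt'] := crossing_towards_end p'M p'0 JP (c'e k).
  have [|m [Jm mr]] := MP _ _ t t' _ Jt Jt'; first by rewrite adj_sym.
  exists m; split=> //; rewrite ltnNge; apply/negP => /sP ms.
  move/negP: kE; apply; apply/allpairsP; exists (m, (act a m^-1 (x k.+1), act a m^-1 (x k)))%g.
  by split=> //=; rewrite !actVK.
have [M1 h1] := far_common_points pM p'M.1 p0 p'0 far.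
have [|M2 h2] := far_common_points p'M pM.1 p'0 p0 (M := M).
  by move=> L; have [m [mL [r [r' [? ?]]]]] := far L; exists m; split=> //; exists r', r.
apply: (@finite_hausdorff_discretize _ _ _ c c' (maxn M1 M2)) => i.
  by have [s hs] := h2 i; exists s; rewrite leq_max hs orbT.
by have [s hs] := h1 i; exists s; rewrite leq_max hs.
Qed.

End TreeEnd.

(** With this [z], the product [g * z] fixes [v]: a group element that crosses an edge at [v] is
    close to the stabiliser of [v]. *)
Lemma vertex_group_near J v : exists K, forall g u, crosses a J u v g ->
  exists2 z, (word_length S z <= K)%N & act a z v = (act a g^-1 v)%g.
Proof.
have /choice[z zP] (w : vertex T) : exists z, (exists g, act a g v = w) -> act a z v = w.
  have [[g gw]|n] := pselect (exists g, act a g v = w); first by exists g.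
  by exists 1%g.
exists (\max_(j <- J) word_length S (z j.2))%N => g u Jg.
exists (z (act a g^-1 v)%g); last by apply: zP; exists g^-1%g.
exact: (@leq_bigmax_seq _ _ xpredT (fun j => word_length S (z j.2)) _ Jg).
Qed.

Lemma mem_vertex_group v g : (g \in vertex_group a v) = (act a g v == v).
Proof. by []. Qed.

(* An excursion away from [v] starts and ends by crossing the same edge at [v], so
   its length is bounded by [crossing_bound]. *)
Lemma sink_near N p v : morse_path S 2 N p -> p 0%N = 1%g ->
  (forall u, adj v u -> ends_in a o u v p) ->
  exists K, forall n, exists h : subgroup (vertex_group a v), (d (p n) (\val h) <= K)%N.
Proof.
move=> pM p0 sink; have pS n := quasi_path_step n pM.1.
have [J [Jsym JP]] := crossing_edges S a o 4.
have [D DP] := crossing_bound edge_empty J 2 N 0.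
have [K1 K1P] := vertex_group_near J v.
have nearV n K : (exists2 h, act a h v = v & (d (p n) h <= K)%N) ->
    exists h : subgroup (vertex_group a v), (d (p n) (\val h) <= K)%N.
  move=> [h hv hn]; have hV : h \in vertex_group a v by rewrite mem_vertex_group hv.
  by exists (exist (fun x => x \in vertex_group a v) h hV).
have [K2 K2P] : exists K, forall n, act a (p n) o = v ->
    exists2 h, act a h v = v & (d (p n) h <= K)%N.
  have [[z zv]|nz] := pselect (exists z, act a z v = o).
    exists (word_length S z) => n nv; exists (p n * z)%g; last by rewrite wd_mul.
    by rewrite actM zv.
  by exists 0%N => n nv; case: nz; exists (p n)^-1%g; rewrite -nv actK.
(* A stay in the branch of [o] may have no entry. There is only one such branch and [p] is out of it
   from [n0] on, so 1 itself is close enough. *)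
have [K3 K3P] : exists K, forall n u, adj v u -> side v u o -> side v u (act a (p n) o) ->
    exists2 h, act a h v = v & (d (p n) h <= K)%N.
  have [[u0 vu0 su0]|nu] := pselect (exists2 u, adj v u & side v u o); last first.
    by exists 0%N => n u vu su; case: nu; exists u.
  have [n0 nP] := sink u0 vu0.
  exists (2 * n0 + 2)%N => n u vu su sn; exists 1%g; first exact: act1.
  have e : u = u0.
    apply/eqP/negPn/negP => uu0; have uv : adj u v by rewrite adj_sym.
    by have := side_nested T_tree uv vu0 uu0 su; exact: side_excl.
  have nn0 : (n < n0)%N.
    rewrite ltnNge; apply/negP => /nP.
    by rewrite -e; apply: side_excl sn => //; rewrite adj_sym.
  have [|_] := pM.1 n 0%N n; first by rewrite leqnn.
  by rewrite p0 wdC; lia.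
exists (maxn (maxn K2 K3) (2 * D + 2 + K1)) => n; apply: nearV.
have [nv|/side_branch[u vu sn]] := eqVneq (act a (p n) o) v.
  by have [h ? hn] := K2P n nv; exists h; rewrite // !leq_max hn.
have [so|nso] := pselect (side v u o).
  by have [h ? hn] := K3P n u vu so sn; exists h; rewrite // !leq_max hn orbT.
have uv : adj u v by rewrite adj_sym.
have sP w : side u v w <-> ~ side v u w by rewrite sideN.
have [m mP] := sink u vu.
(* Any exit [t2] after [n] and any entry [t1] before it will do, since all crossings of one edge lie
   within [D] of each other. *)
have [||t2 [nt2 s2 ns2]] := @last_time (fun t => side v u (act a (p t) o)) n (maxn n m) (leq_maxl _ _).
- exact: sn.
- by apply/sP/mP; rewrite leq_maxr.
have [||t1 [nt1 s1 ns1]] := @last_time (fun t => side u v (act a (p t) o)) 0%N n (leq0n n).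
- by rewrite p0 act1; apply/sP.
- by move/sP; apply.
have J1 : crosses a J u v (p t1) by exact: JP (pS t1) s1 ns1.
have J2 : crosses a J u v (p t2) by apply: Jsym; exact: JP (pS t2) s2 ns2.
have t12 : (t2 - t1 <= D)%N.
  apply: (DP p u v t1 t2 uv pM); first by lia.
  - by exists (p t1); rewrite ?wdxx.
  - by exists (p t2); rewrite ?wdxx.
have [z zK zv] := K1P _ _ J1.
exists (p t1 * z)%g; first by rewrite actM zv actVK.
have := wdD S (p n) (p t1) (p t1 * z)%g; rewrite wd_mul.
have [|_] := pM.1 n t1 n; first by lia.
by rewrite wdC; lia.
Qed.

End Components.

(** * Vertex groups are undistorted *)

Section VertexGroups.
Variables (R : realType) (G : groupType) (S : generators G).
Variables (T : cgraph) (a : graph_action G T).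
Hypothesis T_tree : is_tree T.
Hypothesis a_noinv : without_inversions a.
Hypothesis edge_empty : forall u v : vertex T, adj u v ->
  exists i : cayley_embedding R S (edge_group a u v), rel_boundary i = set0.
Local Notation d := (wd S).

Lemma edge_group_fix u v g : adj u v -> g \in edge_group a u v ->
  act a g u = u /\ act a g v = v.
Proof.
move=> uv /orP[] /andP[/eqP gu /eqP gv]; first by [].
by case: (a_noinv uv (conj gu gv)).
Qed.

Lemma mem_edge_group u v g : act a g u = u -> act a g v = v -> g \in edge_group a u v.
Proof. by move=> gu gv; rewrite unfold_in /edge_group gu gv !eqxx. Qed.

(** Such a chain from 1 is a word in the elements of the vertex group of length at most [B]. *)
Definition jumps v B n (g h : G) : Prop := exists f : nat -> G,
  [/\ f 0%N = g, f n = h, forall k, (k <= n)%N -> act a (f k) v = v &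
    forall k, (k < n)%N -> (d (f k) (f k.+1) <= B)%N].

Lemma jumps1 v B g h : act a g v = v -> act a h v = v -> (d g h <= B)%N -> jumps v B 1 g h.
Proof.
move=> gv hv gh; exists (fun k => if k == 0%N then g else h); split=> //.
  by move=> [|k].
by move=> [|k].
Qed.

Lemma jumps_trans v B m n g h k : jumps v B m g h -> jumps v B n h k -> jumps v B (m + n) g k.
Proof.
move=> [f [f0 fm fv fB]] [e [e0 en ev eB]].
have fe i : (m <= i)%N -> (if (i <= m)%N then f i else e (i - m)%N) = e (i - m)%N.
  by rewrite leq_eqVlt => /orP[/eqP <-|mi]; [rewrite leqnn subnn fm e0|rewrite leqNgt mi].
exists (fun i => if (i <= m)%N then f i else e (i - m)%N); split.
- by [].
- by rewrite fe ?leq_addr// addKn.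
- move=> i imn; have [im|im] := leqP i m; first exact: fv.
  by apply: ev; lia.
- move=> i imn; have [im|im] := ltnP i m; first by rewrite (ltnW im); exact: fB.
  rewrite (fe i im) /=.
  by rewrite subSn//; apply: eB; lia.
Qed.

(* A word path from 1 to [h] is shortcut at [v]: an excursion into the branch of a
   neighbour [u] starts and ends close to one coset of an edge group, and is
   replaced by a geodesic of that undistorted coset. *)
Lemma vertex_group_jumps v : exists B L, forall h, act a h v = v ->
  exists2 n, (n <= L * word_length S h + 1)%N & jumps v B n 1%g h.
Proof.
have [J [Jsym JP]] := crossing_edges S a v 1.
have [K0 K0P] := crosses_coset S a J; have [K1 K1P] := vertex_group_near S a J v.
have [C CP] := edge_qie edge_empty J.
pose K2 := (K0 + K1)%N; pose B := (2 * K2 + 1 + 2 * K1 + 2 * C)%N.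
(* An excursion of [t] steps costs at most [1 + C * (t + K0) + C] jumps, and this is at most [L * t]
   because [0 < t]. *)
pose L := (2 * C + C * K0 + 1)%N.
exists B, L.
(* The induction restarts at the last point of an excursion, which need not fix [v]. Hence [y]
   stands in for [x 0], and the last condition says that [x 1] has left the branch of [x 0]. *)
suff main n : forall x y, act a y v = v -> act a (x n) v = v -> (d y (x 0%N) <= K2)%N ->
    (forall k, (k < n)%N -> (d (x k) (x k.+1) <= 1)%N) ->
    ((0 < n)%N -> forall u, adj v u -> side v u (act a (x 0%N) v) -> ~ side v u (act a (x 1%N) v)) ->
    exists2 m, (m <= L * n + 1)%N & jumps v B m y (x n).
  move=> h hv; have [p [p0 ph pg]] := word_geodesic S h.
  have [] := main (word_length S h) p 1%g.
  - exact: act1.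
  - by rewrite ph.
  - by rewrite p0 wdxx.
  - by move=> k kh; rewrite pg ?subSnn// leqnSn kh.
  - by move=> _ u vu; rewrite p0 act1 => /side_tree; case=> //.
  by move=> m; rewrite ph//; exists m.
elim/ltn_ind: n => n IH x y yv xv yx xS x01.
have [n0|n_gt0] := posnP n.
  exists 1%N; first by rewrite leq_addl.
  by apply: jumps1; rewrite // n0 (leq_trans yx)// /B; lia.
have [x1v|/side_branch[u vu s1]] := eqVneq (act a (x 1%N) v) v.
  have [|||||m mn ym] := IH n.-1 _ (fun k => x k.+1) (x 1%N) x1v _ _ _ _; rewrite ?prednK//.
  - by rewrite wdxx.
  - by move=> k kn; apply: xS; lia.
  - by move=> _ u vu; rewrite x1v => /side_tree; case.
  rewrite prednK// in ym; exists (1 + m)%N.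
    have : (L * n = L * n.-1 + L)%N by rewrite -{1}(prednK n_gt0) mulnS addnC.
    by rewrite /L in mn *; lia.
  apply: jumps_trans ym; apply: jumps1 => //.
  by have := wdD S y (x 0%N) (x 1%N); have := xS 0%N n_gt0; rewrite /B; lia.
have uv : adj u v by rewrite adj_sym.
have sP w : side u v w <-> ~ side v u w by rewrite sideN.
have ns0 : side u v (act a (x 0%N) v) by apply/sP => s0; exact: x01 s1.
have J0 : crosses a J u v (x 0%N) by apply: JP (xS 0%N n_gt0) ns0 _; move/sP.
have [||t [t1 st nst]] := @last_time (fun t => side v u (act a (x t) v)) 1 n n_gt0.
- exact: s1.
- by rewrite xv; exact: side_tree.
have tn : (t < n)%N by lia.
have Jt : crosses a J u v (x t) by apply: Jsym; exact: JP (xS t tn) st nst.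
have uv0 : adj (act a (x 0%N)^-1 u)%g (act a (x 0%N)^-1 v)%g by rewrite act_adj.
have [e eE et] := K0P _ _ _ _ J0 Jt.
have [SH qC] := CP _ J0 uv0.
have [z zK zv] := K1P _ _ J0.
pose e' : subgroup (edge_group a (act a (x 0%N)^-1 u)%g (act a (x 0%N)^-1 v)%g) :=
  exist (fun x => x \in edge_group a _ _) e eE.
have [q [q0 qe qg]] := word_geodesic SH e'.
(* Without inversions [e] fixes the translate of [v] by the inverse of [x 0], so [y'] fixes [v]; it
   is close to [x t] and becomes the next [y]. *)
pose y' := (x 0%N * e * z)%g.
have qv k : act a (x 0%N * \val (q k) * z)%g v = v.
  by rewrite !actM zv (edge_group_fix uv0 (valP (q k))).2 actVK.
have y'v : act a y' v = v.
  by have := qv (word_length SH e'); rewrite qe.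
have ty' : (d y' (x t) <= K2)%N.
  apply: leq_trans (wdD S _ (x 0%N * e)%g _) _.
  by rewrite wdC wd_mul (wdC S _ (x t)) /K2 addnC leq_add.
have xk k : (d (x 0%N) (x k) <= k)%N \/ (n < k)%N.
  elim: k => [|k [kk|kn]]; [by left; rewrite wdxx| |by right; lia].
  have [kn|kn] := leqP n k; first by right; lia.
  by left; have := wdD S (x 0%N) (x k) (x k.+1); have := xS k kn; lia.
have le : (word_length SH e' <= C * (t + K0) + C)%N.
  have [+ _] := qC 1%g e'; rewrite val1 !wd1 => h; apply: leq_trans h _.
  rewrite -[\val e']/e leq_add2r leq_mul2l; apply/orP; right.
  have := wdD S (x 0%N) (x t) (x 0%N * e)%g; rewrite wd_mul.
  have xt : (d (x 0%N) (x t) <= t)%N by have [//|] := xk t; rewrite ltnNge (ltnW tn).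
  by move=> h; apply: leq_trans h _; exact: leq_add.
have j1 : jumps v B 1 y (x 0%N * z)%g.
  apply: jumps1 => //; first by rewrite actM zv actVK.
  by have := wdD S y (x 0%N) (x 0%N * z)%g; rewrite wd_mul /B /K2 in yx *; lia.
have j2 : jumps v B (word_length SH e') (x 0%N * z)%g y'.
  exists (fun k => x 0%N * \val (q k) * z)%g; split=> //.
  - by rewrite q0 val1 mulg1.
  - by rewrite qe.
  move=> k kl; have [_ h] := qC (q k) (q k.+1); rewrite qg ?leqnSn//= subSnn in h.
  apply: leq_trans (wdD S _ (x 0%N * \val (q k))%g _) _; rewrite wdC wd_mul.
  apply: leq_trans (leq_add zK (wdD S _ (x 0%N * \val (q k.+1))%g _)) _.
  rewrite wdM wd_mul; apply: leq_trans (leq_add (leqnn K1) (leq_add h zK)) _.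
  by rewrite /B; clear; lia.
have tn' : (t + (n - t))%N = n by lia.
have [|||||m mn ym] := IH (n - t)%N _ (fun k => x (t + k)%N) y' y'v _ _ _ _; rewrite ?tn'//.
- by lia.
- by rewrite addn0.
- by move=> k kn; rewrite addnS; apply: xS; lia.
- move=> _ u' vu'; rewrite addn0 addn1 => st'.
  have [<- //|uu'] := eqVneq u u'.
  by have := side_excl T_tree _ (side_nested T_tree uv vu' uu' st) st'; rewrite adj_sym => /(_ vu').
rewrite tn' in ym; exists (1 + word_length SH e' + m)%N; last first.
  by apply: jumps_trans ym; exact: jumps_trans j1 j2.
have -> : (L * n = L * t + L * (n - t))%N by rewrite -mulnDr tn'.
have t_gt0 : (0 < t)%N by lia.
have e1 : (C * K0 <= C * K0 * t)%N by rewrite leq_pmulr.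
have e2 : (C <= C * t)%N by rewrite leq_pmulr.
by rewrite /L in mn *; lia.
Qed.

(** The elements of the vertex group in the ball of radius [B] generate it: jumps bound the new
    length linearly by the old one, and each new letter has old length at most [B]. *)
Lemma vertex_group_undistorted v : fg_undistorted R S (vertex_group a v).
Proof.
have [B [L BL]] := vertex_group_jumps v.
have [s sP] := word_ball S B.
pose V := subgroup (vertex_group a v).
pose gs : seq V := [seq h <- pmap insub s | (word_length S (\val h) <= B)%N].
have lettersP (h : V) : (h \in letters gs) = (word_length S (\val h) <= B)%N.
  have mem (k : V) : (k \in gs) = (word_length S (\val k) <= B)%N.
    rewrite mem_filter; case: leqP => //= kB; rewrite mem_pmap_sub; exact: sP.
  by rewrite inE !mem -[\val h^-1%g]/((\val h)^-1)%g word_lengthV orbb.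
have word n : forall g h : V, jumps v B n (\val g) (\val h) ->
    exists w, [/\ all (letters gs) w, (\prod_(x <- w) x = g^-1 * h)%g & size w = n].
  elim: n => [|n IH] g h [f [f0 fn fv fB]].
    exists [::]; split=> //; rewrite big_nil.
    have -> : h = g by apply: val_inj; rewrite -fn -f0.
    by rewrite mulVg.
  have f1V : f 1%N \in vertex_group a v by rewrite mem_vertex_group fv.
  pose k : V := exist (fun x => x \in vertex_group a v) (f 1%N) f1V.
  have [|w [wgs we wn]] := IH k h.
    exists (fun i => f i.+1); split=> // [i ni|i ni]; [exact: fv|exact: fB].
  exists (g^-1 * k :: w)%g; split=> /=; last by rewrite wn.
  - apply/andP; split=> //; rewrite -[letters gs _]/(_ \in letters gs) lettersP.
    by have := fB 0%N isT; rewrite f0.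
  - by rewrite big_cons we -mulgA mulVKg.
have wordh (h : V) : exists w, [/\ all (letters gs) w, (\prod_(x <- w) x = h)%g &
    (size w <= L * word_length S (\val h) + 1)%N].
  have [|n nL j] := BL (\val h); first by apply/eqP; exact: (valP h).
  have [|w [? we wn]] := word n 1%g h; first by rewrite val1.
  by exists w; split; rewrite ?wn// we invg1 mul1g.
have gsP (h : V) : exists2 w, all (letters gs) w & (\prod_(x <- w) x)%g = h.
  by have [w []] := wordh h; exists w.
have C1 : (1 <= (L + B + 1)%:R :> R)%R by rewrite ler1n addn1.
exists (Generators gsP); exists (L + B + 1)%:R%R => // g h _ _.
have -> : word_dist R (Generators gsP) g h = (word_length (Generators gsP) (g^-1 * h)%g)%:R%R by [].
have -> : word_dist R S (\val g) (\val h) = (word_length S (\val (g^-1 * h)%g))%:R%R by [].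
move: (g^-1 * h)%g => {g} {}h; rewrite qi_lower//.
rewrite -natrD -natrM ler_nat -natrM -natrD ler_nat; apply/andP; split.
  have [w [wgs we wl]] := wordh h.
  have := word_length_le (S := Generators gsP) wgs; rewrite we => h1.
  apply: leq_trans h1 (leq_trans wl _); rewrite mulnDr leq_add//.
    by rewrite leq_mul2r -addnA leq_addr orbT.
  by rewrite muln_gt0 addn1.
have [w [wgs <- <-]] := word_lengthP (Generators gsP) h.
apply: (@leq_trans (B * size w)); last first.
  apply: leq_trans (leq_addr _ _); rewrite leq_mul2r; apply/orP; right.
  by rewrite -addnA addnCA leq_addr.
elim: w wgs => [_|x w IH /andP[xgs wgs]]; first by rewrite big_nil val1 word_length1.
rewrite big_cons valM mulnS.
by apply: leq_trans (word_lengthM _ _ _) _; apply: leq_add (IH wgs); rewrite -lettersP.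
Qed.

End VertexGroups.

(** * Common points of two vertex groups, and the conclusion *)

Section Intersections.
Variables (G : groupType) (S : generators G).
Local Open Scope group_scope.

(** The pair [(g^-1 * h1, g^-1 * h2)] takes finitely many values. One [z j] moving it into [H1] and
    [H2] is fixed for each, and [g * (z j)^-1] lies in both groups. *)
Lemma near_intersection (H1 H2 : groupClosed G) K : exists K', forall g,
  (exists2 h, h \in H1 & (wd S g h <= K)%N) -> (exists2 h, h \in H2 & (wd S g h <= K)%N) ->
  exists h, [/\ h \in H1, h \in H2 & (wd S g h <= K')%N].
Proof.
have [s sP] := word_ball S K.
pose common (j : G * G) z := z * j.1 \in H1 /\ z * j.2 \in H2.
have /choice[z zP] (j : G * G) : exists z, (exists g, common j g) -> common j z.
  by have [[g gP]|n] := pselect (exists g, common j g); [exists g|exists 1].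
exists (\max_(j <- [seq (x, y) | x <- s, y <- s]) word_length S (z j))%N => g
  [h1 H1h1 gh1] [h2 H2h2 gh2].
pose j := (g^-1 * h1, g^-1 * h2).
have [|z1 z2] := zP j; first by exists g; rewrite /common /= !mulVKg.
exists (g * (z j)^-1); split.
- have -> : g * (z j)^-1 = h1 * (z j * j.1)^-1 by rewrite /= !invgM invgK -!mulgA mulVKg.
  by rewrite gpredM// gpredV.
- have -> : g * (z j)^-1 = h2 * (z j * j.2)^-1 by rewrite /= !invgM invgK -!mulgA mulVKg.
  by rewrite gpredM// gpredV.
rewrite wd_mul word_lengthV; apply: leq_bigmax_seq => //.
by apply: allpairs_f; exact: sP.
Qed.

End Intersections.

(** Being fixed, [x] lies both in the branch of [u] at [v] and in that of its image under [g];
    distinct branches are disjoint. *)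
Lemma fixed_edge (G : groupType) (T : cgraph) (a : graph_action G T) (T_tree : is_tree T)
    (v u x : vertex T) g : adj v u -> side v u x -> act a g v = v -> act a g x = x ->
  act a g u = u.
Proof.
move=> vu sx gv gx; apply/eqP/negPn/negP => gu.
have vgu : adj v (act a g u) by rewrite -gv act_adj.
have sgx : side v (act a g u) x by rewrite -gv -gx; exact/side_act.
have uv : adj u v by rewrite adj_sym.
have := side_nested T_tree uv vgu _ sx; rewrite eq_sym gu => /(_ isT).
exact: side_excl sgx.
Qed.

Theorem theorem1 (R : realType) (G : groupType) (S : generators G)
  (T : cgraph) (a : graph_action G T)
  (T_tree : is_tree T)
  (a_noinv : without_inversions a)
  (a_nonell : ~ elliptic a)
  (edge_undistorted : forall u v : vertex T, adj u v ->
     fg_undistorted R S (edge_group a u v))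
  (edge_empty : forall u v : vertex T, adj u v ->
     exists i : cayley_embedding R S (edge_group a u v), rel_boundary i = set0) :
  (forall C : set (group_morse_boundary R S),
     (exists xi, C = connected_component setT xi) ->
     ~ (exists xi, C = [set xi]) ->
     exists2 v : vertex T,
       fg_undistorted R S (vertex_group a v) &
       forall i : cayley_embedding R S (vertex_group a v),
         C `<=` rel_boundary_image i) /\
  (forall v1 v2 : vertex T, ~ (vertex_group a v1 =i vertex_group a v2) ->
     forall (i1 : cayley_embedding R S (vertex_group a v1))
            (i2 : cayley_embedding R S (vertex_group a v2)),
       rel_boundary_image i1 `&` rel_boundary_image i2 = set0).
Proof.
have endpoint_surj (xi : group_morse_boundary R S) : exists c, xi = endpoint c.
  by exists (repr xi); rewrite /endpoint reprK.
split=> [C [xi Cxi] Cns|v1 v2 v12 i1 i2].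
  have [o] := T_tree.1.
  have Cx : C xi by rewrite Cxi; exact: connected_component_refl.
  have [[v sink]|nsink] := pselect (exists v, forall u, adj v u -> C `<=` toward a o u v).
    exists v; first exact: vertex_group_undistorted.
    move=> i eta; have [c ->] := endpoint_surj eta => Cc.
    have [N cN] := morse_ray_path c.
    have ends u : adj v u -> ends_in a o u v (discretize (\val c)).
      move=> vu; have uv : adj u v by rewrite adj_sym.
      by apply/(toward_endpoint o edge_empty c uv); exact: sink.
    have [K near] := sink_near T_tree edge_empty cN (discretize0 (morse_ray_geodesic c)) ends.
    exact: boundary_image_of_near near.
  have /choice[nxt nxtP] v : exists u, adj v u /\ C `<=` toward a o v u.
    apply: contrapT => nu; apply: nsink; exists v => u vu.
    have [] := component_toward o T_tree edge_empty xi vu; rewrite -Cxi => // Cvu.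
    by case: nu; exists u.
  pose x k := iter k nxt o.
  have xA k : adj (x k) (x k.+1) by have [] := nxtP (x k).
  have xC k : C `<=` toward a o (x k) (x k.+1) by have [] := nxtP (x k).
  (* Turning back would put [xi] on both sides of one edge. *)
  have xN k : x k.+2 != x k.
    apply/eqP => e; have := xC k.+1 _ Cx; rewrite e.
    by rewrite -(towardC o T_tree edge_empty (xA k)); apply; exact: xC.
  have ends c : C (endpoint c) -> forall k, ends_in a o (x k) (x k.+1) (discretize (\val c)).
    by move=> Cc k; apply/(toward_endpoint o edge_empty c (xA k)); exact: xC.
  case: Cns; exists xi; apply/seteqP; split=> [eta|_ -> //].
  have [c ->] := endpoint_surj eta; move: Cx; have [c' ->] := endpoint_surj xi => Cc' Cc.
  by apply/endpointP; apply: (end_asymptotic T_tree edge_empty (x := x)) => //; exact: ends.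
apply/seteqP; split=> // eta []; have [c ->] := endpoint_surj eta.
move=> /near_of_boundary_image[K1 near1] /near_of_boundary_image[K2 near2].
have v21 : v2 != v1 by apply/eqP => e; apply: v12 => g; rewrite e.
(* Elements fixing [v1] and [v2] also fix the first edge of the path between them, so the whole ray
   would stay close to one edge group, against [coset_bound]. *)
have [u vu su] := side_branch v21.
have [i i0] := edge_empty _ _ vu.
have [N [cN cM]] := morse_ray_path c.
have [K KP] := near_intersection S (vertex_group a v1) (vertex_group a v2) (maxn K1 K2).
have near n : exists h : subgroup (edge_group a v1 u), (wd S (discretize (\val c) n) (1 * \val h)%g <= K)%N.
  have [||h [hv1 hv2 hK]] := KP (discretize (\val c) n).
  - by have [h hn] := near1 n; exists (\val h); [exact: valP|rewrite leq_max hn].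
  - by have [h hn] := near2 n; exists (\val h); [exact: valP|rewrite leq_max hn orbT].
  move: hv1 hv2; rewrite !mem_vertex_group => /eqP hv1 /eqP hv2.
  have hE : h \in edge_group a v1 u by apply: mem_edge_group => //; exact: fixed_edge su hv1 hv2.
  by exists (exist (fun x => x \in edge_group a v1 u) h hE); rewrite mul1g.
have [D DP] := coset_bound 2 N K i0.
have := DP (discretize (\val c)) 0%N D.+1 1%g (conj cN cM) (leq0n _) (near 0%N) (near D.+1).
by rewrite subn0 ltnn.
Qed.
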